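(* Let $\pi:(\mathbf{M},\nabla,g_m)\to(\mathbf{B},\nabla^{*},g_b)$ be a conformal submersion with horizontal distribution, with conformal factor given by $\phi\in C^\infty(\mathbf{M})$, where $\nabla$ is torsion-free. Let $\sigma$ be a geodesic of $\mathbf{M}$ (with respect to $\nabla$), and put $X=\mathcal{H}(\sigma')$ and $U=\mathcal{V}(\sigma')$. Then $\pi\circ\sigma$ is a geodesic of $\mathbf{B}$ (with respect to $\nabla^*$) if and only if, along $\sigma$, $$\pi_{*}(2A_{X}U+T_{U}U)+2X(\phi)\,\pi_{*}X=\|X\|^{2}\,\pi_{*}(\mathrm{grad}_{\pi}\phi),$$ where $\|X\|^{2}=g_m(X,X)$.
   Context: All objects are smooth. $(\mathbf{M},g_m)$, $(\mathbf{B},g_b)$ are Riemannian manifolds with $\dim\mathbf{M}>\dim\mathbf{B}$. A submersion $\pi:\mathbf{M}\to\mathbf{B}$ is a surjective map with $\pi_{*p}:T_p\mathbf{M}\to T_{\pi(p)}\mathbf{B}$ surjective for all $p$. Put $\mathcal{V}(\mathbf{M})_p=\ker\pi_{*p}$ (vertical subspace) and let $\mathcal{H}(\mathbf{M})_p=\mathcal{V}(\mathbf{M})_p^{\perp}$ be its $g_m$-orthogonal complement (horizontal subspace), so $T_p\mathbf{M}=\mathcal{V}(\mathbf{M})_p\oplus\mathcal{H}(\mathbf{M})_p$. $\mathcal{H}$ and $\mathcal{V}$ also denote the projections onto the horizontal and vertical subspaces. $\mathcal{X}(\mathbf{B})$ is the set of vector fields on $\mathbf{B}$; for $X\in\mathcal{X}(\mathbf{B})$,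 $\tilde X$ is its unique horizontal lift to $\mathbf{M}$. A submersion $\pi:(\mathbf{M},g_m)\to(\mathbf{B},g_b)$ is a conformal submersion if there is $\phi\in C^\infty(\mathbf{M})$ with $g_m(X,Y)=e^{2\phi}g_b(\pi_*X,\pi_*Y)$ for all horizontal vector fields $X,Y$ on $\mathbf{M}$. Given such $\pi$ and $\phi$, and affine connections $\nabla$ on $\mathbf{M}$ and $\nabla^*$ on $\mathbf{B}$ (not necessarily Levi-Civita), $\pi:(\mathbf{M},\nabla,g_m)\to(\mathbf{B},\nabla^*,g_b)$ is a conformal submersion with horizontal distribution if for all $X,Y\in\mathcal{X}(\mathbf{B})$ $$\mathcal{H}(\nabla_{\tilde X}\tilde Y)=\widetilde{(\nabla^*_XY)}+\tilde X(\phi)\tilde Y+\tilde Y(\phi)\tilde X-\mathcal{H}(\mathrm{grad}_\pi\phi)\,g_m(\tilde X,\tilde Y),$$ where $\mathrm{grad}_\pi\phi$ is the gradient of $\phi$ with respect to $g_m$. The fundamental tensors are the $(1,2)$-tensors on $\mathbf{M}$ given by $$T_EF=\mathcal{H}(\nabla_{\mathcal{V}E}\mathcal{V}F)+\mathcal{V}(\nabla_{\mathcal{V}E}\mathcal{H}F),\qquad A_EF=\mathcal{V}(\nabla_{\mathcal{H}E}\mathcal{H}F)+\mathcal{H}(\nabla_{\mathcal{H}E}\mathcal{V}F)$$ for vector fields $E,F$ on $\mathbf{M}$. A geodesic is a curve $\sigma$ with $\nabla_{\sigma'}\sigma'=0$ for the connection in question. *)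

(* Defs.v *)
From HB Require Import structures.
From mathcomp Require Import all_boot all_order all_algebra.
From mathcomp Require Import all_classical all_reals all_analysis.

Set Implicit Arguments.
Unset Strict Implicit.
Unset Printing Implicit Defensive.

Import Order.TTheory GRing.Theory Num.Theory numFieldNormedType.Exports.
Local Open Scope classical_set_scope.
Local Open Scope ring_scope.

(* Meant for open sets [U] of a finite-dimensional [V]. *)
Fixpoint Ck_on (R : realType) (V W : normedModType R) (k : nat) (U : set V)
    (f : V -> W) : Prop :=
  match k with
  | 0%N => forall x, U x -> {for x, continuous f}
  | k'.+1 => (forall x, U x -> differentiable f x) /\
             (forall v, Ck_on k' U (fun x => 'D_v f x))
  end.

Definition smooth_on (R : realType) (V W : normedModType R) (U : set V)
    (f : V -> W) : Prop := forall k, Ck_on k U f.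

(* The atlas need not be maximal. The maps [chart_map c] and [chart_inv c] are
   total; only their restrictions to the chart domain and to its image matter. *)
Record smoothManifold (R : realType) (n : nat) : Type := SmoothManifold {
  manifold_carrier :> topologicalType;
  manifold_hausdorff : hausdorff_space manifold_carrier;
  manifold_second_countable : @second_countable manifold_carrier;
  chart : Type;
  chart_dom : chart -> set manifold_carrier;
  chart_map : chart -> manifold_carrier -> 'rV[R]_n;
  chart_inv : chart -> 'rV[R]_n -> manifold_carrier;
  chart_dom_open : forall c, open (chart_dom c);
  chart_img_open : forall c, open (chart_map c @` chart_dom c);
  chart_mapK : forall c p, chart_dom c p -> chart_inv c (chart_map c p) = p;
  chart_map_continuous : forall c p, chart_dom c p ->
    {for p, continuous (chart_map c)};
  chart_inv_continuous : forall c x, (chart_map c @` chart_dom c) x ->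
    {for x, continuous (chart_inv c)};
  chart_cover : forall p, exists c, chart_dom c p;
  chart_transition : forall c d,
    smooth_on (chart_map c @` (chart_dom c `&` chart_dom d))
              (chart_map d \o chart_inv c)
}.

Definition chart_at (R : realType) (n : nat) (M : smoothManifold R n) (p : M) :
  chart M := projT1 (cid (chart_cover p)).

(* A tangent vector at [p] is represented by its components in the preferred
   chart [chart_at p]; its components in any other chart around [p] are given
   by [tangent_coord]. *)
Definition tangent (R : realType) (n : nat) (M : smoothManifold R n) (p : M) :
  Type := 'rV[R]_n.

HB.instance Definition _ (R : realType) (n : nat) (M : smoothManifold R n)
  (p : M) := GRing.Lmodule.copy (tangent p) 'rV[R]_n.

Definition tangent_coord (R : realType) (n : nat) (M : smoothManifold R n)
    (c : chart M) (p : M) (v : tangent p) : 'rV[R]_n :=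
  'd (chart_map c \o chart_inv (chart_at p)) (chart_map (chart_at p) p) v.

Definition smooth_function (R : realType) (n : nat) (M : smoothManifold R n)
    (f : M -> R) : Prop :=
  forall c, smooth_on (chart_map c @` chart_dom c) (f \o chart_inv c).

Definition smooth_map (R : realType) (m n : nat) (M : smoothManifold R m)
    (N : smoothManifold R n) (F : M -> N) : Prop :=
  continuous F /\
  forall c d, smooth_on (chart_map c @` (chart_dom c `&` F @^-1` chart_dom d))
                        (chart_map d \o F \o chart_inv c).

(* [v(f)], the derivative of the function [f] in the direction [v]. *)
Definition dfunction (R : realType) (n : nat) (M : smoothManifold R n)
    (f : M -> R) (p : M) (v : tangent p) : R :=
  'd (f \o chart_inv (chart_at p)) (chart_map (chart_at p) p) v.

Definition tangent_map (R : realType) (m n : nat) (M : smoothManifold R m)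
    (N : smoothManifold R n) (F : M -> N) (p : M) (v : tangent p) :
    tangent (F p) :=
  'd (chart_map (chart_at (F p)) \o F \o chart_inv (chart_at p))
     (chart_map (chart_at p) p) v.

Definition vector_field (R : realType) (n : nat) (M : smoothManifold R n) :
  Type := forall p : M, tangent p.

Definition smooth_field (R : realType) (n : nat) (M : smoothManifold R n)
    (X : vector_field M) : Prop :=
  forall c, smooth_on (chart_map c @` chart_dom c)
    (fun x => tangent_coord c (X (chart_inv c x))).

(* [Z = [X, Y]], vector fields being identified with derivations. *)
Definition is_lie_bracket (R : realType) (n : nat) (M : smoothManifold R n)
    (X Y Z : vector_field M) : Prop :=
  forall f : M -> R, smooth_function f -> forall p : M,
    dfunction f (Z p) =
    dfunction (fun q => dfunction f (Y q)) (X p) -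
    dfunction (fun q => dfunction f (X q)) (Y p).

Record riemannianMetric (R : realType) (n : nat) (M : smoothManifold R n) :
    Type := RiemannianMetric {
  metric :> forall p : M, tangent p -> tangent p -> R;
  metric_sym : forall p (u v : tangent p), metric u v = metric v u;
  metric_linear : forall p (a : R) (u v w : tangent p),
    metric (a *: u + v) w = a * metric u w + metric v w;
  metric_pos : forall p (u : tangent p), u != 0 -> 0 < metric u u;
  metric_smooth : forall X Y : vector_field M,
    smooth_field X -> smooth_field Y ->
    smooth_function (fun p => metric (X p) (Y p))
}.

(* Values of [conn] on fields that are not smooth are irrelevant. *)
Record affineConnection (R : realType) (n : nat) (M : smoothManifold R n) :
    Type := AffineConnection {
  conn :> vector_field M -> vector_field M -> vector_field M;
  conn_smooth : forall X Y, smooth_field X -> smooth_field Y ->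
    smooth_field (conn X Y);
  conn_linear_l : forall (f : M -> R) X X' Y, smooth_function f ->
    smooth_field X -> smooth_field X' -> smooth_field Y ->
    forall p, conn (fun q => f q *: X q + X' q) Y p
              = f p *: conn X Y p + conn X' Y p;
  conn_additive_r : forall X Y Y',
    smooth_field X -> smooth_field Y -> smooth_field Y' ->
    forall p, conn X (fun q => Y q + Y' q) p = conn X Y p + conn X Y' p;
  conn_leibniz : forall (f : M -> R) X Y, smooth_function f ->
    smooth_field X -> smooth_field Y ->
    forall p, conn X (fun q => f q *: Y q) p
              = dfunction f (X p) *: Y p + f p *: conn X Y p
}.

Definition torsion_free (R : realType) (n : nat) (M : smoothManifold R n)
    (nabla : affineConnection M) : Prop :=
  forall X Y, smooth_field X -> smooth_field Y ->
    is_lie_bracket X Y (fun p => nabla X Y p - nabla Y X p).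

(* A smooth vector field taking the value [v] at [p]; used to evaluate at a
   point expressions that are tensorial in a vector field. *)
Definition extension (R : realType) (n : nat) (M : smoothManifold R n) (p : M)
    (v : tangent p) : vector_field M :=
  xget (fun=> 0) [set E : vector_field M | smooth_field E /\ E p = v].

(* [nabla_v Y] for a single tangent vector [v]. *)
Definition conn_at (R : realType) (n : nat) (M : smoothManifold R n)
    (nabla : affineConnection M) (p : M) (v : tangent p) (Y : vector_field M) :
    tangent p := nabla (extension v) Y p.

Definition smooth_curve (R : realType) (n : nat) (M : smoothManifold R n)
    (I : set R) (s : R -> M) : Prop :=
  (forall t, I t -> {for t, continuous s}) /\
  forall c, smooth_on (I `&` s @^-1` chart_dom c) (chart_map c \o s).

Definition velocity (R : realType) (n : nat) (M : smoothManifold R n)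
    (s : R -> M) (t : R) : tangent (s t) :=
  'D_1 (chart_map (chart_at (s t)) \o s) t.

(* [w] is the covariant derivative at [t] of the field [V] along the curve [s].
   [V] itself need not extend to a vector field on [M], but near [t] it is a
   combination of fields [E i \o s] with coefficients depending on the
   parameter; [w] is then given by the Leibniz rule together with
   [D(E \o s)/dt = nabla_(s') E], and does not depend on the decomposition. *)
Definition is_covariant_derivative (R : realType) (n : nat)
    (M : smoothManifold R n) (nabla : affineConnection M) (s : R -> M)
    (V : forall t, tangent (s t)) (t : R) (w : tangent (s t)) : Prop :=
  exists (k : nat) (a : 'I_k -> R -> R) (E : 'I_k -> vector_field M),
    [/\ forall i, smooth_field (E i),
        forall i, derivable (a i) t 1,
        \forall r \near t, V r = \sum_(i < k) a i r *: E i (s r) &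
        w = \sum_(i < k) ('D_1 (a i) t *: E i (s t)
                          + a i t *: conn_at nabla (velocity s t) (E i))].

Definition geodesic (R : realType) (n : nat) (M : smoothManifold R n)
    (nabla : affineConnection M) (I : set R) (s : R -> M) : Prop :=
  smooth_curve I s /\
  forall t, I t -> is_covariant_derivative nabla (velocity s) (0 : tangent (s t)).

Definition gradient (R : realType) (n : nat) (M : smoothManifold R n)
    (g : riemannianMetric M) (f : M -> R) : vector_field M :=
  fun p => xget 0 [set w | forall v : tangent p, g p w v = dfunction f v].

Definition submersion (R : realType) (m n : nat) (M : smoothManifold R m)
    (B : smoothManifold R n) (pi : M -> B) : Prop :=
  [/\ smooth_map pi,
      forall b, exists p, pi p = b &
      forall (p : M) (w : tangent (pi p)),
        exists v : tangent p, tangent_map pi v = w].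

Definition vertical (R : realType) (m n : nat) (M : smoothManifold R m)
    (B : smoothManifold R n) (pi : M -> B) (p : M) : set (tangent p) :=
  [set v | tangent_map pi v = 0].

Definition horizontal (R : realType) (m n : nat) (M : smoothManifold R m)
    (B : smoothManifold R n) (g : riemannianMetric M) (pi : M -> B) (p : M) :
    set (tangent p) :=
  [set v | forall u, vertical pi u -> g p v u = 0].

Definition hproj (R : realType) (m n : nat) (M : smoothManifold R m)
    (B : smoothManifold R n) (g : riemannianMetric M) (pi : M -> B) (p : M)
    (v : tangent p) : tangent p :=
  xget 0 [set h | horizontal g pi h /\ vertical pi (v - h)].

Definition vproj (R : realType) (m n : nat) (M : smoothManifold R m)
    (B : smoothManifold R n) (g : riemannianMetric M) (pi : M -> B) (p : M)
    (v : tangent p) : tangent p := v - hproj g pi v.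

Definition hlift (R : realType) (m n : nat) (M : smoothManifold R m)
    (B : smoothManifold R n) (g : riemannianMetric M) (pi : M -> B)
    (X : vector_field B) : vector_field M :=
  fun p => xget 0 [set v | horizontal g pi v /\ tangent_map pi v = X (pi p)].

Definition conformal_submersion (R : realType) (m n : nat)
    (M : smoothManifold R m) (B : smoothManifold R n)
    (gM : riemannianMetric M) (gB : riemannianMetric B) (pi : M -> B)
    (phi : M -> R) : Prop :=
  [/\ submersion pi,
      smooth_function phi &
      forall X Y : vector_field M, smooth_field X -> smooth_field Y ->
        (forall p, horizontal gM pi (X p)) ->
        (forall p, horizontal gM pi (Y p)) ->
        forall p, gM p (X p) (Y p) =
          expR (2 * phi p) *
          gB (pi p) (tangent_map pi (X p)) (tangent_map pi (Y p))].

Definition conformal_submersion_hdist (R : realType) (m n : nat)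
    (M : smoothManifold R m) (B : smoothManifold R n)
    (nablaM : affineConnection M) (gM : riemannianMetric M)
    (nablaB : affineConnection B) (gB : riemannianMetric B)
    (pi : M -> B) (phi : M -> R) : Prop :=
  conformal_submersion gM gB pi phi /\
  forall X Y : vector_field B, smooth_field X -> smooth_field Y ->
    let X' := hlift gM pi X in
    let Y' := hlift gM pi Y in
    forall p : M,
      hproj gM pi (nablaM X' Y' p) =
      hlift gM pi (nablaB X Y) p
      + dfunction phi (X' p) *: Y' p
      + dfunction phi (Y' p) *: X' p
      - gM p (X' p) (Y' p) *: hproj gM pi (gradient gM phi p).

Definition tensorT_field (R : realType) (m n : nat) (M : smoothManifold R m)
    (B : smoothManifold R n) (nabla : affineConnection M)
    (g : riemannianMetric M) (pi : M -> B) (E F : vector_field M) :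
    vector_field M :=
  let hor := fun Z : vector_field M => fun p => hproj g pi (Z p) in
  let ver := fun Z : vector_field M => fun p => vproj g pi (Z p) in
  fun p => hor (nabla (ver E) (ver F)) p + ver (nabla (ver E) (hor F)) p.

Definition tensorA_field (R : realType) (m n : nat) (M : smoothManifold R m)
    (B : smoothManifold R n) (nabla : affineConnection M)
    (g : riemannianMetric M) (pi : M -> B) (E F : vector_field M) :
    vector_field M :=
  let hor := fun Z : vector_field M => fun p => hproj g pi (Z p) in
  let ver := fun Z : vector_field M => fun p => vproj g pi (Z p) in
  fun p => ver (nabla (hor E) (hor F)) p + hor (nabla (hor E) (ver F)) p.

Definition tensorT (R : realType) (m n : nat) (M : smoothManifold R m)
    (B : smoothManifold R n) (nabla : affineConnection M)
    (g : riemannianMetric M) (pi : M -> B) (p : M) (u v : tangent p) :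
    tangent p :=
  tensorT_field nabla g pi (extension u) (extension v) p.

Definition tensorA (R : realType) (m n : nat) (M : smoothManifold R m)
    (B : smoothManifold R n) (nabla : affineConnection M)
    (g : riemannianMetric M) (pi : M -> B) (p : M) (u v : tangent p) :
    tangent p :=
  tensorA_field nabla g pi (extension u) (extension v) p.

(* Main.v *)
(* In charts around p and pi(p), with Christoffel symbols G and G*, put
     Q(u, v) = d2f(u, v) - df(G(u, v)) + G*(df u, df v),  f = pi in coordinates,
   the second fundamental form of the map pi. Differentiating twice the image
   of a geodesic sigma gives
     nabla*_{(pi o sigma)'} (pi o sigma)' = Q(sigma', sigma').
   Differentiating dpi(W) = Y o pi, for a field W that is pi-related to Y, gives
     dpi(nabla_E W) = nabla*_{dpi E} Y - Q(E, W).
   For horizontal lifts, Q is therefore read off the axiom of a conformal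
   submersion with horizontal distribution; for vertical W (Y = 0), it gives
   Q(X, U) = - dpi(A_X U) and Q(U, U) = - dpi(T_U U). Torsion-freeness, tested on
   the coordinates of pi, yields Q(X, U) = Q(U, X), and the theorem is the
   expansion of Q(X + U, X + U) = 0. *)
Require Import Defs.
From HB Require Import structures.
From mathcomp Require Import all_boot all_order all_algebra.
From mathcomp Require Import all_classical all_reals all_analysis.
From mathcomp Require Import lra ring.
Import Order.TTheory GRing.Theory Num.Theory numFieldNormedType.Exports.
Local Open Scope classical_set_scope.
Local Open Scope ring_scope.

Set Implicit Arguments.
Unset Strict Implicit.
Unset Printing Implicit Defensive.

(** * Calculus of smooth functions on normed spaces *)

Section calculus.
Variable R : realType.
Implicit Types V W : normedModType R.

(** The definitions speak of global objects: [nabla] is constrained only on smooth fields of the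
    whole manifold, and a Lie bracket is tested on global functions. Local computations therefore
    rest on cutoffs. Moreover [hlift], [hproj] and [extension] are choices with a default value:
    before the axioms on connections apply, the chosen objects must be shown to exist and to be
    smooth. For the horizontal ones an explicit formula does this: a lift solves a linear system,
    built from the metric and the Jacobian of [pi], whose matrix is invertible. The connection on
    [B] may have torsion, so Q need not be symmetric; torsion-freeness on [M] makes Q minus its last
    term symmetric. That term vanishes as soon as one argument is vertical, and the two equal mixed
    values give the factor 2 of [A_X U]. Finally, a covariant derivative along a curve is a
    relation: its coordinate formula yields uniqueness, while existence is a separate fact, used to
    conclude that the image curve is a geodesic. *)

Lemma near0_differentiable V W (f : V -> W) (x : V) :
  (\forall y \near x, f y = 0) -> differentiable f x.
Proof.
move=> f0.
have f0' : \forall h \near (0:V), f (h + x) = 0.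
  by move: f0; rewrite (near_shift 0 x) subr0.
have fE : f \o shift x = cst (f x) + (\0 : {linear V -> W}) +o_ 0 id.
  apply/eqaddoP => e e0; near=> h.
  rewrite !fctE /= (nbhs_singleton f0) addr0 subr0.
  suff -> : f (h + x) = 0 by rewrite normr0 mulr_ge0// ltW.
  by near: h.
have c0 : continuous (\0 : {linear V -> W}) by move=> y; exact: cvg_cst.
by apply/diff_locallyP; rewrite (diff_unique c0 fE).
Unshelve. all: by end_near. Qed.

(** Differentiability is local because [g = f + (g - f)], where the difference vanishes near [x] and
    so has differential 0. *)
Lemma near_eq_differentiable V W (f g : V -> W) (x : V) :
  (\forall y \near x, f y = g y) -> differentiable f x -> differentiable g x.
Proof.
move=> fg df; have -> : g = f + (g - f) by rewrite addrC subrK.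
apply: differentiableD => //; apply: near0_differentiable.
by apply: filterS fg => y fgy; rewrite !fctE fgy subrr.
Qed.

Lemma near_eq_diff V W (f g : V -> W) (x : V) :
  (\forall y \near x, f y = g y) -> differentiable f x ->
  'd f x = 'd g x :> (V -> W).
Proof.
move=> fg df; have dg := near_eq_differentiable fg df.
by apply/funext => v; rewrite -!deriveE//; exact: near_eq_derive.
Qed.

Lemma Ck_on_sub V W k (U U' : set V) (f : V -> W) :
  U' `<=` U -> Ck_on k U f -> Ck_on k U' f.
Proof.
move=> sU; elim: k f => [|k IH] f /= => [fU x /sU/fU //|[df Df]].
by split=> [x /sU/df //|v]; exact: IH.
Qed.

Lemma Ck_on_ext V W k (U : set V) (f g : V -> W) : open U ->
  (forall x, U x -> f x = g x) -> Ck_on k U f -> Ck_on k U g.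
Proof.
move=> oU; elim: k f g => [|k IH] f g fg /=.
  move=> fU x Ux; apply: cvg_trans (_ : f @ x --> g x); last first.
    by rewrite -fg//; exact: fU.
  apply: near_eq_cvg; near=> y.
  by apply: fg; near: y; exact: open_nbhs_nbhs.
move=> [df Df].
have fgx x : U x -> \forall y \near x, f y = g y.
  by move=> Ux; near=> y; apply: fg; near: y; exact: open_nbhs_nbhs.
split=> [x Ux|v]; first exact: near_eq_differentiable (fgx x Ux) (df x Ux).
by apply: IH (Df v) => x Ux; exact: near_eq_derive (fgx x Ux).
Unshelve. all: by end_near. Qed.

Lemma Ck_onW V W k (U : set V) (f : V -> W) : Ck_on k.+1 U f -> Ck_on k U f.
Proof.
elim: k f => [|k IH] f [df Df]; first by move=> x /df/differentiable_continuous.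
by split=> // v; exact: IH.
Qed.

Lemma Ck_on_cst V W k (U : set V) (w : W) : Ck_on k U (cst w : V -> W).
Proof.
elim: k w => [|k IH] w; first by move=> x _; exact: cvg_cst.
split=> [x _|v]; first exact: differentiable_cst.
by rewrite (_ : (fun x => _) = cst 0)//; apply/funext => x; rewrite derive_cst.
Qed.

Lemma Ck_onD V W k (U : set V) (f g : V -> W) : open U ->
  Ck_on k U f -> Ck_on k U g -> Ck_on k U (fun x => f x + g x).
Proof.
move=> oU; elim: k f g => [|k IH] f g.
  by move=> cf cg x Ux; apply: cvgD; [exact: cf|exact: cg].
move=> [df Df] [dg Dg]; split=> [x Ux|v].
  by apply: differentiableD; [exact: df|exact: dg].
apply: Ck_on_ext (IH _ _ (Df v) (Dg v)) => // x Ux.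
by rewrite deriveD//; apply: diff_derivable; [exact: df|exact: dg].
Qed.

Lemma Ck_on_linear V W W' k (U : set V) (L : {linear W -> W'}) (f : V -> W) :
  open U -> continuous L -> Ck_on k U f -> Ck_on k U (fun x => L (f x)).
Proof.
move=> oU cL; have dL y : differentiable L y by exact: linear_differentiable.
elim: k f => [|k IH] f.
  by move=> cf x Ux; apply: continuous_comp (cf x Ux) _; exact: cL.
move=> [df Df]; split=> [x Ux|v].
  by apply: differentiable_comp; first exact: df.
apply: Ck_on_ext (IH _ (Df v)) => // x Ux.
have dLf : differentiable (L \o f) x by apply: differentiable_comp; first exact: df.
rewrite -[RHS]/('D_v (L \o f) x) (deriveE _ dLf) (deriveE _ (df x Ux)).
by have dfx := df x Ux; rewrite [in RHS]diff_comp//= (diff_lin _ cL).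
Qed.

Lemma Ck_onM V k (U : set V) (f g : V -> R) : open U ->
  Ck_on k U f -> Ck_on k U g -> Ck_on k U (fun x => f x * g x).
Proof.
move=> oU; elim: k f g => [|k IH] f g.
  by move=> cf cg x Ux; apply: cvgM; [exact: cf|exact: cg].
move=> Cf Cg; have [[df Df] [dg Dg]] := (Cf, Cg); split=> [x Ux|v].
  by apply: differentiableM; [exact: df|exact: dg].
apply: Ck_on_ext (Ck_onD oU (IH _ _ (Ck_onW Cf) (Dg v))
                            (IH _ _ (Ck_onW Cg) (Df v))) => // x Ux.
by rewrite deriveM//; apply: diff_derivable; [exact: df|exact: dg].
Qed.

(** The induction closes because the derivative of [1/f] is a product of [-1], two copies of [1/f]
    and ['D_v f], all of class [k]. *)
Lemma Ck_onV V k (U : set V) (f : V -> R) : open U ->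
  (forall x, U x -> f x != 0) -> Ck_on k U f -> Ck_on k U (fun x => (f x)^-1).
Proof.
move=> oU f0; elim: k => [|k IH].
  by move=> cf x Ux; apply: cvgV; [exact: f0|exact: cf].
move=> Cf; have [df Df] := Cf; have CV := IH (Ck_onW Cf).
split=> [x Ux|v]; first by apply: differentiableV; [exact: df|exact: f0].
have C1 : Ck_on k U (cst (-1) : V -> R) by exact: Ck_on_cst.
apply: Ck_on_ext (Ck_onM oU C1 (Ck_onM oU (Ck_onM oU CV CV) (Df v))) => // x Ux.
rewrite deriveV//; [|exact: f0|exact: diff_derivable (df x Ux)].
by rewrite /cst mulN1r -exprVn expr2 scaleNr.
Qed.

Lemma Ck_on_sum V W k (U : set V) I (r : seq I) (P : pred I)
    (f : I -> V -> W) : open U -> (forall i, P i -> Ck_on k U (f i)) ->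
  Ck_on k U (fun x => \sum_(i <- r | P i) f i x).
Proof.
move=> oU Cf; rewrite (_ : (fun x => _) = \sum_(i <- r | P i) f i); last first.
  by apply/funext => x; rewrite fct_sumE.
by apply: (big_ind (Ck_on k U)) => //; [exact: Ck_on_cst|move=> g h; exact: Ck_onD].
Qed.

(** [e] and [co] stand for a finite basis of [W] and its coordinate forms. They turn the chain rule
    into a sum of derivatives of [g] in the fixed directions [e i], which are the ones that [Ck_on]
    controls; in the direction ['D_v f x], which varies with [x], the induction hypothesis could not
    be applied. *)
Lemma Ck_on_comp V W k m (e : 'I_m -> W) (co : 'I_m -> {linear W -> R})
    (U : set V) (U' : set W) (f : V -> W) (g : W -> R) :
  (forall w, w = \sum_i co i w *: e i) -> (forall i, continuous (co i)) ->
  open U -> (forall x, U x -> U' (f x)) ->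
  Ck_on k U f -> Ck_on k U' g -> Ck_on k U (fun x => g (f x)).
Proof.
move=> coE cco oU fU; elim: k f g fU => [|k IH] f g fU.
  by move=> cf cg x Ux; apply: continuous_comp (cf x Ux) _; apply/cg/fU.
move=> Cf [dg Dg]; have [df Df] := Cf.
split=> [x Ux|v]; first by apply: differentiable_comp (df x Ux) _; apply/dg/fU.
have CD : Ck_on k U (fun x => \sum_i co i ('D_v f x) * 'D_(e i) g (f x)).
  apply: Ck_on_sum => // i _; apply: Ck_onM => //.
    exact: Ck_on_linear (Df v).
  by apply: IH (Ck_onW Cf) (Dg _).
apply: Ck_on_ext CD => // x Ux.
have dfx := df x Ux; have dgx := dg _ (fU x Ux).
have dgf : differentiable (g \o f) x by exact: differentiable_comp.
rewrite -[RHS]/('D_v (g \o f) x) [RHS]deriveE// diff_comp//= -(deriveE v dfx).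
rewrite [in RHS](coE ('D_v f x)) linear_sum; apply: eq_bigr => i _.
by rewrite linearZ /= (deriveE _ dgx).
Qed.

End calculus.

(** * Smoothness of germs *)

Section smooth_at.
Variable R : realType.
Implicit Types V W : normedModType R.

Definition rcoord n (i : 'I_n) (v : 'rV[R]_n) : R := v 0 i.

Lemma rcoord_is_linear n (i : 'I_n) : linear (rcoord i).
Proof. by move=> a u v; rewrite /rcoord !mxE. Qed.

HB.instance Definition _ n (i : 'I_n) :=
  GRing.isLinear.Build R 'rV[R]_n R _ (rcoord i) (rcoord_is_linear i).

Lemma rcoord_continuous n (i : 'I_n) : continuous (rcoord i).
Proof. exact: coord_continuous. Qed.

Lemma Ck_on_comp_row V n k (U : set V) (U' : set 'rV[R]_n) f (g : _ -> R) :
  open U -> (forall x, U x -> U' (f x)) ->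
  Ck_on k U f -> Ck_on k U' g -> Ck_on k U (fun x => g (f x)).
Proof.
apply: (@Ck_on_comp _ _ _ _ _ (fun i => delta_mx 0 i) (@rcoord n)).
  by move=> w; rewrite -[RHS]row_sum_delta.
by move=> i; exact: rcoord_continuous.
Qed.

Lemma Ck_on_comp_real V k (U : set V) (U' : set R) f (g : R -> R) :
  open U -> (forall x, U x -> U' (f x)) ->
  Ck_on k U f -> Ck_on k U' g -> Ck_on k U (fun x => g (f x)).
Proof.
apply: (@Ck_on_comp R V R k 1 (fun=> 1) (fun=> idfun : {linear R -> R})).
  by move=> w; rewrite big_ord1 /= [RHS]mulr1.
by move=> i x; exact: cvg_id.
Qed.

Lemma Ck_on_local V W k (U : set V) (f : V -> W) :
  (forall x, U x -> exists N : set V, [/\ open N, N x & Ck_on k N f]) ->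
  Ck_on k U f.
Proof.
elim: k f => [|k IH] f loc; first by move=> x /loc [N [oN Nx H]]; apply: H.
split=> [x /loc[N [_ Nx []]] + _|v]; first exact.
by apply: IH => x /loc[N [oN Nx [df Df]]]; exists N; split => //; exact: Df.
Qed.

(** One neighbourhood serves all orders. Working with germs allows functions given by chart formulas
    on different domains to be combined without tracking these domains. *)
Definition smooth_at V W (x : V) (f : V -> W) : Prop :=
  exists N : set V, [/\ open N, N x & smooth_on N f].

Lemma smooth_on_smooth_at V W (U : set V) (f : V -> W) x :
  open U -> smooth_on U f -> U x -> smooth_at x f.
Proof. by exists U. Qed.

Lemma smooth_at_smooth_on V W (U : set V) (f : V -> W) :
  (forall x, U x -> smooth_at x f) -> smooth_on U f.
Proof.
move=> sf k; apply: Ck_on_local => x /sf[N [oN Nx fN]].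
by exists N; split => //; exact: fN.
Qed.

Lemma smooth_at_near V W (x : V) (f : V -> W) :
  smooth_at x f -> \forall y \near x, smooth_at y f.
Proof.
move=> [N [oN Nx fN]]; near=> y; exists N; split => //.
by near: y; exact: open_nbhs_nbhs.
Unshelve. all: by end_near. Qed.

Lemma smooth_at_restr V W (x : V) (f : V -> W) (P : V -> Prop) :
  smooth_at x f -> (\forall y \near x, P y) ->
  exists N : set V, [/\ open N, N x, smooth_on N f & forall y, N y -> P y].
Proof.
move=> [N [oN Nx fN]]; rewrite /prop_near1 nbhsE => -[N' [oN' N'x] sO'].
exists (N `&` N'); split; [exact: openI|by []| |by move=> y [_ /sO']].
by move=> k; apply: Ck_on_sub (fN k) => y [].
Qed.

Lemma smooth_at_ext V W (x : V) (f g : V -> W) :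
  (\forall y \near x, f y = g y) -> smooth_at x f -> smooth_at x g.
Proof.
move=> fg sf; have [N [oN Nx fN fgO]] := smooth_at_restr sf fg.
by exists N; split => // k; exact: Ck_on_ext (fN k).
Qed.

Lemma smooth_at_differentiable V W (x : V) (f : V -> W) :
  smooth_at x f -> differentiable f x.
Proof. by move=> [N [oN Nx /(_ 1%N)[df _]]]; exact: df. Qed.

Lemma smooth_at_continuous V W (x : V) (f : V -> W) :
  smooth_at x f -> {for x, continuous f}.
Proof. by move/smooth_at_differentiable/differentiable_continuous. Qed.

Lemma smooth_at_derive V W (x : V) (f : V -> W) v :
  smooth_at x f -> smooth_at x ('D_v f).
Proof. by move=> [N [oN Nx fN]]; exists N; split => // k; case: (fN k.+1) => _; apply. Qed.

Lemma smooth_at_cst V W (x : V) (w : W) : smooth_at x (fun=> w).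
Proof. by exists setT; split => [||k]; [exact: openT| |exact: Ck_on_cst]. Qed.

(** Transfers a closure property of [Ck_on] to germs on the intersection of the two neighbourhoods;
    unary operations are covered by taking [f] and [g] equal. *)
Lemma smooth_at_lift2 V W W' W'' (x : V) (f : V -> W) (g : V -> W') (h : V -> W'') :
  (forall k (N : set V), open N -> Ck_on k N f -> Ck_on k N g -> Ck_on k N h) ->
  smooth_at x f -> smooth_at x g -> smooth_at x h.
Proof.
move=> H [N [oN Nx fN]] [N' [oN' N'x gO']].
exists (N `&` N'); split => [||k]; [exact: openI|by []|apply: H; first exact: openI].
  by apply: Ck_on_sub (fN k) => y [].
by apply: Ck_on_sub (gO' k) => y [].
Qed.

Lemma smooth_atD V W (x : V) (f g : V -> W) :
  smooth_at x f -> smooth_at x g -> smooth_at x (fun y => f y + g y).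
Proof. by apply: smooth_at_lift2 => k N; exact: Ck_onD. Qed.

Lemma smooth_atM V (x : V) (f g : V -> R) :
  smooth_at x f -> smooth_at x g -> smooth_at x (fun y => f y * g y).
Proof. by apply: smooth_at_lift2 => k N; exact: Ck_onM. Qed.

Lemma smooth_at_linear V W W' (L : {linear W -> W'}) (x : V) (f : V -> W) :
  continuous L -> smooth_at x f -> smooth_at x (fun y => L (f y)).
Proof.
by move=> cL sf; apply: smooth_at_lift2 (sf) (sf) => k N ? ? ?; exact: Ck_on_linear.
Qed.

Lemma smooth_atN V W (x : V) (f : V -> W) :
  smooth_at x f -> smooth_at x (fun y => - f y).
Proof.
apply: (@smooth_at_linear _ _ _ (-%R : {linear W -> W})) => y.
exact: opp_continuous.
Qed.

Lemma smooth_atB V W (x : V) (f g : V -> W) :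
  smooth_at x f -> smooth_at x g -> smooth_at x (fun y => f y - g y).
Proof. by move=> sf /smooth_atN; exact: smooth_atD. Qed.

Lemma smooth_at_sum V W (x : V) I (r : seq I) (P : pred I) (f : I -> V -> W) :
  (forall i, P i -> smooth_at x (f i)) ->
  smooth_at x (fun y => \sum_(i <- r | P i) f i y).
Proof.
move=> sf; rewrite (_ : (fun y => _) = \sum_(i <- r | P i) f i); last first.
  by apply/funext => y; rewrite fct_sumE.
apply: (big_ind (@smooth_at V W x)) => //; first exact: smooth_at_cst.
by move=> g h; exact: smooth_atD.
Qed.

Lemma smooth_at_prod V (x : V) I (r : seq I) (P : pred I) (f : I -> V -> R) :
  (forall i, P i -> smooth_at x (f i)) ->
  smooth_at x (fun y => \prod_(i <- r | P i) f i y).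
Proof.
move=> sf; rewrite (_ : (fun y => _) =
    \big[(fun f g y => f y * g y)/cst 1]_(i <- r | P i) f i); last first.
  by apply/funext => y; elim/big_rec2: _ => // i z g _ ->.
apply: (big_ind (@smooth_at V R x)) => //; first exact: smooth_at_cst.
by move=> g h; exact: smooth_atM.
Qed.

Lemma smooth_at_row V n (x : V) (f : V -> 'rV[R]_n) :
  (forall i, smooth_at x (fun y => f y 0 i)) -> smooth_at x f.
Proof.
move=> sf; rewrite (_ : f = (fun y => \sum_i (f y 0 i) *: delta_mx 0 i)); last first.
  by apply/funext => y; exact: row_sum_delta.
apply: smooth_at_sum => i _.
pose L : R -> 'rV[R]_n := fun a => a *: delta_mx 0 i.
have Llin : linear L by move=> a u v; rewrite /L scalerDl scalerA.
pose LL : {linear R -> 'rV[R]_n} :=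
  HB.pack L (GRing.isLinear.Build R R 'rV[R]_n _ L Llin).
by apply: (@smooth_at_linear _ _ _ LL) => // a; exact: scalel_continuous.
Qed.

Lemma smooth_at_coord V n (x : V) (f : V -> 'rV[R]_n) i :
  smooth_at x f -> smooth_at x (fun y => f y 0 i).
Proof. by apply: (@smooth_at_linear _ _ _ (rcoord i)); exact: rcoord_continuous. Qed.

Lemma smooth_atV V (x : V) (f : V -> R) :
  smooth_at x f -> f x != 0 -> smooth_at x (fun y => (f y)^-1).
Proof.
move=> sf fx0.
have f0 : \forall y \near x, f y != 0.
  have cf := smooth_at_continuous sf.
  by near=> y; near: y; apply: (cvgr_neq0 _ cf).
have [N [oN Nx fN f0O]] := smooth_at_restr sf f0.
by exists N; split => // k; apply: Ck_onV => //; exact: fN.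
Unshelve. all: by end_near. Qed.

Lemma smooth_at_comp_real V (x : V) (f : V -> R) (g : R -> R) :
  smooth_at x f -> smooth_at (f x) g -> smooth_at x (fun y => g (f y)).
Proof.
move=> sf [N' [oN' N'fx gO']].
have fN' : \forall y \near x, N' (f y).
  by apply: (smooth_at_continuous sf); exact: open_nbhs_nbhs.
have [N [oN Nx fN {}fN']] := smooth_at_restr sf fN'.
by exists N; split => // k; exact: Ck_on_comp_real (fN k) (gO' k).
Qed.

Lemma smooth_at_comp1 V n (x : V) (f : V -> 'rV[R]_n) (g : 'rV[R]_n -> R) :
  smooth_at x f -> smooth_at (f x) g -> smooth_at x (fun y => g (f y)).
Proof.
move=> sf [N' [oN' N'fx gO']].
have fN' : \forall y \near x, N' (f y).
  by apply: (smooth_at_continuous sf); exact: open_nbhs_nbhs.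
have [N [oN Nx fN {}fN']] := smooth_at_restr sf fN'.
by exists N; split => // k; exact: Ck_on_comp_row (fN k) (gO' k).
Qed.

Lemma smooth_at_comp V n p (x : V) (f : V -> 'rV[R]_n) (g : 'rV[R]_n -> 'rV[R]_p) :
  smooth_at x f -> smooth_at (f x) g -> smooth_at x (fun y => g (f y)).
Proof.
move=> sf sg; apply: smooth_at_row => i.
by apply: (smooth_at_comp1 sf (smooth_at_coord i sg)).
Qed.

Lemma smooth_atZ V n (x : V) (a : V -> R) (f : V -> 'rV[R]_n) :
  smooth_at x a -> smooth_at x f -> smooth_at x (fun y => a y *: f y).
Proof.
move=> sa sf; apply: smooth_at_row => i.
apply: smooth_at_ext (smooth_atM sa (smooth_at_coord i sf)).
by near=> y; rewrite mxE.
Unshelve. all: by end_near. Qed.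

Lemma smooth_at_id V (x : V) : smooth_at x id.
Proof.
exists setT; split => // [|[|k]]; first exact: openT.
  by move=> y _; exact: cvg_id.
split=> [y _|v]; first by have [] := is_diff_id y.
rewrite (_ : (fun y => _) = cst v); first exact: Ck_on_cst.
by apply/funext => y; rewrite derive_id.
Qed.

Lemma diff_sum_delta n W (f : 'rV[R]_n -> W) (x w : 'rV[R]_n) :
  differentiable f x -> 'd f x w = \sum_i w 0 i *: 'D_(delta_mx 0 i) f x.
Proof.
move=> df; rewrite [in LHS](row_sum_delta w) linear_sum; apply: eq_bigr => i _.
by rewrite linearZ /= deriveE.
Qed.

(** The direction moves with the point, so near [x] the differential is expanded into partial
    derivatives, each smooth, with the coordinates of [w] as coefficients. *)
Lemma smooth_at_diff n p (x : 'rV[R]_n) (f : 'rV[R]_n -> 'rV[R]_p) w :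
  smooth_at x f -> smooth_at x w -> smooth_at x (fun y => 'd f y (w y)).
Proof.
move=> sf sw.
apply: (@smooth_at_ext _ _ _ (fun y => \sum_i w y 0 i *: 'D_(delta_mx 0 i) f y)).
  near=> y; rewrite -diff_sum_delta//; apply: smooth_at_differentiable.
  near: y; exact: (smooth_at_near sf).
by apply: smooth_at_sum => i _; apply: smooth_atZ;
  [exact: smooth_at_coord|exact: smooth_at_derive].
Unshelve. all: by end_near. Qed.

Lemma smooth_at_det V n (x : V) (A : V -> 'M[R]_n) :
  (forall i j, smooth_at x (fun y => A y i j)) ->
  smooth_at x (fun y => \det (A y)).
Proof.
move=> sA; apply: smooth_at_sum => s _; apply: smooth_atM.
  exact: smooth_at_cst.
by apply: smooth_at_prod => i _.
Qed.

(** Cramer's formula: each entry is a cofactor divided by the determinant, which stays nonzero near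
    [x]. *)
Lemma smooth_at_invmx V n (x : V) (A : V -> 'M[R]_n) :
  (forall i j, smooth_at x (fun y => A y i j)) -> A x \in unitmx ->
  forall i j, smooth_at x (fun y => invmx (A y) i j).
Proof.
move=> sA uA i j; have sdet := smooth_at_det sA.
have det0 : \det (A x) != 0 by rewrite -unitfE -unitmxE.
apply: (@smooth_at_ext _ _ _ (fun y => (\det (A y))^-1 * cofactor (A y) j i)).
  have := smooth_at_continuous sdet => cdet; near=> y.
  have dety : \det (A y) != 0 by near: y; apply: (cvgr_neq0 _ cdet).
  by rewrite /invmx unitmxE unitfE dety !mxE.
apply: smooth_atM; first exact: smooth_atV.
apply: smooth_atM; first exact: smooth_at_cst.
by apply: smooth_at_det => k l; apply: smooth_at_ext (sA (lift j k) (lift i l));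
  near=> y; rewrite !mxE.
Unshelve. all: by end_near. Qed.

End smooth_at.

(** * Bump functions *)

Section bump.
Variable R : realType.

(** The classical flat function is the case [k = 0]. The factor [t^-k] makes the family stable under
    differentiation up to linear combinations, so that one induction reaches all derivatives. *)
Definition flat (k : nat) (t : R) : R :=
  if 0 < t then (t^-1) ^+ k * expR (- t^-1) else 0.

(** From [v^(k+1) / (k+1)! <= exp v] at [v = 1/t]. The linear bound gives the limit 0 of the
    difference quotients at the origin. *)
Lemma flat_le k (t : R) : `|flat k t| <= (k.+1)`!%:R * `|t|.
Proof.
rewrite /flat; case: ifPn => [t0|_]; last by rewrite normr0 mulr_ge0.
have v0 : 0 < t^-1 by rewrite invr_gt0.
rewrite (gtr0_norm t0) ger0_norm; last first.
  by rewrite mulr_ge0 ?expR_ge0// exprn_ge0// ltW.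
rewrite expRN ler_pdivrMr ?expR_gt0//.
have := @expR_ge1Dxn _ (t^-1) k (ltW v0).
have f0 : 0 < (k.+1)`!%:R :> R by rewrite ltr0n fact_gt0.
move=> /(le_trans (ltW _)) -/(_ (t^-1 ^+ k.+1 / (k.+1)`!%:R)).
rewrite ltrDr ltr01 => /(_ isT); rewrite ler_pdivrMr// => H.
have -> : t^-1 ^+ k = t^-1 ^+ k.+1 * t.
  by rewrite exprSr -mulrA mulVf ?mulr1// gt_eqF.
by rewrite mulrAC ler_pM2r// [leRHS]mulrC.
Qed.

Lemma flat_derive k (t : R) :
  is_derive t 1 (flat k) (flat k.+2 t - k%:R * flat k.+1 t).
Proof.
have [t0|t0|->] := ltrgtP t 0.
- have nt (s : R) j : s < 0 -> flat j s = 0 by move=> s0; rewrite /flat ltNge (ltW s0).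
  rewrite !nt// mulr0 subrr; have := @is_derive_cst _ R R 0 t 1.
  apply: near_eq_is_derive; near=> s; rewrite nt//.
  by near: s; exact: lt_nbhsl.
- have pt (s : R) j : 0 < s -> flat j s = (s^-1) ^+ j * expR (- s^-1).
    by rewrite /flat => ->.
  rewrite !pt//.
  have dV : is_derive t 1 (fun s : R => s^-1) (- t ^- 2 *: 1).
    by apply: is_deriveV; rewrite ?gt_eqF.
  have dX := is_deriveX k dV.
  have dE := is_derive1_comp (is_derive_expR _) (is_deriveN dV).
  have D := is_deriveM dX dE.
  have : is_derive t 1 (fun s => (s^-1) ^+ k * expR (- s^-1)) 
     (t^-1 ^+ k.+2 * expR (- t^-1) - k%:R * (t^-1 ^+ k.+1 * expR (- t^-1))).
    rewrite (_ : (fun s => _) =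
        (fun s : R => s^-1) ^+ k * (expR \o - (fun s : R => s^-1))); last first.
      by apply/funext => s; rewrite !fctE.
    apply: (is_derive_eq D).
    case: k {D dX} => [|k] /=; rewrite !fctE /= ?expr0 -!exprVn /GRing.scale /=.
      by ring.
    by rewrite !exprS; ring.
  apply: near_eq_is_derive; near=> s; rewrite pt//.
  by near: s; exact: lt_nbhsr.
- have f0 j : flat j 0 = 0 by rewrite /flat ltxx.
  rewrite !f0 mulr0 subrr.
  (* The difference quotient of [flat k] at 0 is exactly [flat k.+1 h]. *)
  have H : (fun h => h^-1 *: (flat k (h *: 1 + 0) - flat k 0)) @ 0^' --> (0 : R).
    have flatS h : h^-1 * flat k h = flat k.+1 h.
      by rewrite /flat; case: ifP => // _; rewrite ?mulr0// mulrA -exprS.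
    apply/cvgr0Pnorm_le => e e0; near=> h.
    rewrite f0 subr0 addr0 [_ *: 1]mulr1 /GRing.scale /= flatS.
    apply: le_trans (flat_le _ _) _.
    have fp : 0 < (k.+2)`!%:R :> R by rewrite ltr0n fact_gt0.
    rewrite mulrC -ler_pdivlMr//; near: h; apply: dnbhs0_le.
    by rewrite divr_gt0.
  apply: DeriveDef; first by apply/cvg_ex; exists 0.
  exact: cvg_lim H.
Unshelve. all: by end_near. Qed.

Lemma flat_Ck k j (U : set R) : Ck_on j U (flat k).
Proof.
suff : Ck_on j setT (flat k) by apply: Ck_on_sub.
elim: j k => [|j IH] k.
  move=> t _; apply/differentiable_continuous/derivable1_diffP.
  by have [] := flat_derive k t.
split=> [t _|v].
  by apply/derivable1_diffP; have [] := flat_derive k t.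
have -> : 'D_v (flat k) = fun t => v * (flat k.+2 t + (- k%:R) * flat k.+1 t).
  apply/funext => t; have d := flat_derive k t.
  rewrite deriveE; last by apply/derivable1_diffP; case: d.
  rewrite -[v in LHS]mulr1 -[v * 1]/(v *: 1) linearZ /= -deriveE; last first.
    by apply/derivable1_diffP; case: d.
  by rewrite derive_val mulNr.
have oT := @openT R.
apply: Ck_onM => //; first exact: Ck_on_cst.
by apply: Ck_onD => //; apply: Ck_onM => //; exact: Ck_on_cst.
Qed.

Lemma smooth_at_flat k (t : R) : smooth_at t (flat k).
Proof. by exists setT; split => [||j]; [exact: openT| |exact: flat_Ck]. Qed.

Lemma flat0_lt (s t : R) : 0 < t -> s < t -> flat 0 s < flat 0 t.
Proof.
move=> t0 st; rewrite /flat t0 !expr0 !mul1r; case: ifPn => [s0|_].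
  by rewrite ltr_expR ltrN2 ltf_pV2.
exact: expR_gt0.
Qed.

Lemma bump_exists n (a : 'rV[R]_n) (r : R) : 0 < r ->
  exists b : 'rV[R]_n -> R, [/\ forall x, smooth_at x b,
    \forall x \near a, b x = 1 & forall x, r < `|x - a| -> b x = 0].
Proof.
(* The norm on rows is the maximum norm, hence the smooth substitute [rho]. With [e] half of [r^2],
   a coordinate larger than [r] forces [rho - e > e], so that [flat 0 (rho - e)] exceeds
   [c = flat 0 e]. *)
move=> r0; pose e := r ^+ 2 / 2; have e0 : 0 < e by rewrite divr_gt0// exprn_gt0.
pose rho (x : 'rV[R]_n) := \sum_i (x 0 i - a 0 i) ^+ 2.
pose c := flat 0 e.
have c0 : 0 < c by rewrite /c /flat e0 expr0 mul1r expR_gt0.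
have flat0 s : s <= 0 -> flat 0 s = 0 by move=> s0; rewrite /flat ltNge s0.
have fc0 : 0 < flat 0 c by rewrite /flat c0 expr0 mul1r expR_gt0.
have srho x : smooth_at x rho.
  apply: smooth_at_sum => i _.
  have s1 : smooth_at x (fun y : 'rV[R]_n => y 0 i - a 0 i).
    apply: smooth_atB; last exact: smooth_at_cst.
    by apply: smooth_at_coord; exact: smooth_at_id.
  by apply: (smooth_atM s1 s1).
(* The inner [flat] is 0 where [rho <= e], which gives the value [flat 0 c] to be normalised; where
   it exceeds [c], the outer [flat] is 0. *)
exists (fun x => (flat 0 c)^-1 * flat 0 (c - flat 0 (rho x - e))); split.
- move=> x; apply: smooth_atM; first exact: smooth_at_cst.
  apply: (@smooth_at_comp_real _ _ _ (fun x => c - flat 0 (rho x - e)) (flat 0));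
    last exact: smooth_at_flat.
  apply: smooth_atB; first exact: smooth_at_cst.
  apply: (@smooth_at_comp_real _ _ _ (fun x => rho x - e) (flat 0));
    last exact: smooth_at_flat.
  by apply: smooth_atB => //; exact: smooth_at_cst.
- have rhoa : rho a = 0 by rewrite /rho big1// => i _; rewrite subrr expr0n.
  near=> x; rewrite (flat0 (rho x - e)) ?subr0 ?mulVf ?gt_eqF//.
  rewrite subr_le0 ltW//; near: x; apply: (cvgr_lt (rho a)); last by rewrite rhoa.
  exact: (smooth_at_continuous (srho a)).
- move=> x rx.
  have [i ri] : exists i, r < `|x 0 i - a 0 i|.
    apply/not_existsP => H; move: rx; rewrite ltNge => /negP; apply.
    rewrite [leLHS]/Num.norm /= mx_normrE; apply: bigmax_le; first exact: ltW.
    move=> [j i] _ /=; rewrite ord1 !mxE leNgt; apply/negP; exact: H.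
  have re : e < rho x - e.
    rewrite ltrBrDr -splitr /rho (bigD1 i)//= -[ltLHS]addr0.
    apply: ltr_leD; last by apply: sumr_ge0 => j _; exact: sqr_ge0.
    by rewrite -[ltRHS]real_normK ?num_real// ltr_pXn2r// nnegrE ltW.
  by rewrite (flat0 (c - _)) ?mulr0// subr_le0 ltW// flat0_lt// (lt_trans e0).
Unshelve. all: by end_near. Qed.

End bump.

(** * Charts and tangent vectors *)

Section charts.
Variables (R : realType) (n : nat) (M : smoothManifold R n).
Implicit Types (c d : chart M) (p q : M).

Lemma chart_at_dom p : chart_dom (chart_at p) p.
Proof. by rewrite /chart_at; case: cid. Qed.

Lemma chart_img c p : chart_dom c p -> (chart_map c @` chart_dom c) (chart_map c p).
Proof. by exists p. Qed.

Lemma chart_invK c x : (chart_map c @` chart_dom c) x ->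
  chart_map c (chart_inv c x) = x.
Proof. by move=> [p cp <-]; rewrite chart_mapK. Qed.

Lemma chart_inv_dom c x : (chart_map c @` chart_dom c) x ->
  chart_dom c (chart_inv c x).
Proof. by move=> [p cp <-]; rewrite chart_mapK. Qed.

Lemma near_dom c p : chart_dom c p -> \forall q \near p, chart_dom c q.
Proof. by move=> cp; apply: open_nbhs_nbhs; split => //; exact: chart_dom_open. Qed.

Lemma near_img c p : chart_dom c p ->
  \forall x \near chart_map c p, (chart_map c @` chart_dom c) x.
Proof.
move=> cp; apply: open_nbhs_nbhs; split; first exact: chart_img_open.
exact: chart_img.
Qed.

Lemma near_chart_inv c p (P : M -> Prop) : chart_dom c p ->
  (\forall q \near p, P q) -> \forall x \near chart_map c p, P (chart_inv c x).
Proof.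
move=> cp Pp.
suff H : chart_inv c @ chart_map c p --> p by exact: H.
rewrite -[X in _ --> X](chart_mapK cp).
exact: (chart_inv_continuous (chart_img cp)).
Qed.

Lemma near_chart_map c p (P : 'rV[R]_n -> Prop) : chart_dom c p ->
  (\forall x \near chart_map c p, P x) -> \forall q \near p, P (chart_map c q).
Proof. by move=> cp; exact: (chart_map_continuous cp). Qed.

Lemma open_chart_image c (A : set M) : open A ->
  open (chart_map c @` (chart_dom c `&` A)).
Proof.
move=> oA; rewrite openE => _ [p [cp Ap] <-].
have nA : \forall q \near p, A q by exact: open_nbhs_nbhs.
rewrite /interior; near=> x.
have cx : (chart_map c @` chart_dom c) x by near: x; exact: near_img.
exists (chart_inv c x); last exact: chart_invK.
split; first exact: chart_inv_dom.
by near: x; exact: near_chart_inv.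
Unshelve. all: by end_near. Qed.

Lemma smooth_at_transition c d p : chart_dom c p -> chart_dom d p ->
  smooth_at (chart_map c p) (chart_map d \o chart_inv c).
Proof.
move=> cp dp; apply: smooth_on_smooth_at (chart_transition c d) _.
  exact/open_chart_image/chart_dom_open.
by exists p.
Qed.

Lemma chart_comp_eq W c d p (f : M -> W) : chart_dom c p -> chart_dom d p ->
  \forall x \near chart_map c p,
    (f \o chart_inv d) ((chart_map d \o chart_inv c) x) = (f \o chart_inv c) x.
Proof.
move=> cp dp; near=> x.
rewrite /= chart_mapK//; near: x; apply: near_chart_inv => //; exact: near_dom.
Unshelve. all: by end_near. Qed.

(** The chain rule through the transition map. With [W = R] it governs derivatives of functions,
    with [W] a row space the components of tangent vectors. *)
Lemma diff_chart (W : normedModType R) c d p (f : M -> W) v :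
  chart_dom c p -> chart_dom d p ->
  differentiable (f \o chart_inv d) (chart_map d p) ->
  'd (f \o chart_inv c) (chart_map c p) v =
  'd (f \o chart_inv d) (chart_map d p)
    ('d (chart_map d \o chart_inv c) (chart_map c p) v).
Proof.
move=> cp dp df.
have dt := smooth_at_differentiable (smooth_at_transition cp dp).
have df' : differentiable (f \o chart_inv d)
    ((chart_map d \o chart_inv c) (chart_map c p)) by rewrite /= chart_mapK.
have E := near_eq_diff (chart_comp_eq f cp dp) (differentiable_comp dt df').
have E1 := congr1 (fun g : _ -> _ => g v) E.
have E2 := congr1 (fun g : _ -> _ => g v) (diff_comp dt df').
have E3 := etrans (esym E1) E2.
apply: (etrans E3).
have q : (chart_map d \o chart_inv c) (chart_map c p) = chart_map d p.
  by rewrite /= chart_mapK.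
exact: (congr1 (fun x => 'd (f \o chart_inv d) x
  ('d (chart_map d \o chart_inv c) (chart_map c p) v)) q).
Qed.

Lemma smooth_at_chart1 c d p (f : M -> R) : chart_dom c p -> chart_dom d p ->
  smooth_at (chart_map d p) (f \o chart_inv d) ->
  smooth_at (chart_map c p) (f \o chart_inv c).
Proof.
move=> cp dp sf; apply: smooth_at_ext (chart_comp_eq f cp dp) _.
apply: (smooth_at_comp1 (smooth_at_transition cp dp)).
by rewrite /= chart_mapK.
Qed.

Lemma smooth_function_at (f : M -> R) c p : smooth_function f -> chart_dom c p ->
  smooth_at (chart_map c p) (f \o chart_inv c).
Proof.
move=> sf cp; apply: smooth_on_smooth_at (sf c) (chart_img cp).
exact: chart_img_open.
Qed.

(** Smoothness asks for all charts; the smooth transitions make one chart around each point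
    enough. *)
Lemma smooth_functionP (f : M -> R) :
  (forall p, exists2 c, chart_dom c p &
     smooth_at (chart_map c p) (f \o chart_inv c)) -> smooth_function f.
Proof.
move=> sf c; apply: smooth_at_smooth_on => _ [p cp <-].
by have [d dp sd] := sf p; exact: smooth_at_chart1 dp sd.
Qed.

Lemma tangent_coordD c p (u v : tangent p) :
  tangent_coord c (u + v) = tangent_coord c u + tangent_coord c v.
Proof. by rewrite /tangent_coord; exact: linearD. Qed.

Lemma tangent_coordZ c p a (u : tangent p) :
  tangent_coord c (a *: u) = a *: tangent_coord c u.
Proof. by rewrite /tangent_coord; exact: linearZZ. Qed.

Lemma tangent_coordB c p (u v : tangent p) :
  tangent_coord c (u - v) = tangent_coord c u - tangent_coord c v.
Proof. by rewrite /tangent_coord; exact: linearB. Qed.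

Lemma tangent_coord0 c p : tangent_coord c (0 : tangent p) = 0.
Proof. by rewrite /tangent_coord; exact: linear0. Qed.

Lemma tangent_coord_sum c p I (r : seq I) (u : I -> tangent p) :
  tangent_coord c (\sum_(i <- r) u i) = \sum_(i <- r) tangent_coord c (u i).
Proof. by rewrite /tangent_coord; exact: linear_sum. Qed.

Lemma tangent_coord_change c d p (v : tangent p) :
  chart_dom c p -> chart_dom d p ->
  tangent_coord d v =
  'd (chart_map d \o chart_inv c) (chart_map c p) (tangent_coord c v).
Proof.
move=> cp dp; rewrite /tangent_coord; apply: diff_chart => //.
  exact: chart_at_dom.
exact: smooth_at_differentiable (smooth_at_transition cp dp).
Qed.

Lemma diff_transition_id c p v : chart_dom c p ->
  'd (chart_map c \o chart_inv c) (chart_map c p) v = v.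
Proof.
move=> cp; have e : \forall x \near chart_map c p,
    (chart_map c \o chart_inv c) x = id x.
  by near=> x; rewrite /= chart_invK//; near: x; exact: near_img.
have dt := smooth_at_differentiable (smooth_at_transition cp cp).
by rewrite (near_eq_diff e dt) diff_val.
Unshelve. all: by end_near. Qed.

Lemma tangent_coord_at p (v : tangent p) : tangent_coord (chart_at p) v = v.
Proof. by rewrite /tangent_coord diff_transition_id//; exact: chart_at_dom. Qed.

(** The inverse of [tangent_coord c] at points of the domain of [c]; elsewhere its value carries no
    meaning. *)
Definition tangent_of c p (w : 'rV[R]_n) : tangent p :=
  'd (chart_map (chart_at p) \o chart_inv c) (chart_map c p) w.

Lemma tangent_ofK c p w : chart_dom c p -> tangent_coord c (tangent_of c p w) = w.
Proof.
move=> cp; rewrite /tangent_coord /tangent_of -diff_chart//.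
- exact: diff_transition_id.
- exact: chart_at_dom.
exact/smooth_at_differentiable/smooth_at_transition/cp/chart_at_dom.
Qed.

Lemma tangent_coordK c p (v : tangent p) : chart_dom c p ->
  tangent_of c p (tangent_coord c v) = v.
Proof.
move=> cp; rewrite /tangent_of -tangent_coord_change ?tangent_coord_at//.
exact: chart_at_dom.
Qed.

Lemma tangent_coord_inj c p (u v : tangent p) : chart_dom c p ->
  tangent_coord c u = tangent_coord c v -> u = v.
Proof. by move=> cp uv; rewrite -(tangent_coordK u cp) uv tangent_coordK. Qed.

Lemma dfunction_coord (f : M -> R) c p (v : tangent p) : chart_dom c p ->
  differentiable (f \o chart_inv c) (chart_map c p) ->
  dfunction f v = 'd (f \o chart_inv c) (chart_map c p) (tangent_coord c v).
Proof.
by move=> cp df; exact: (diff_chart v (chart_at_dom p) cp df).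
Qed.

Definition field_coord c (X : vector_field M) (x : 'rV[R]_n) : 'rV[R]_n :=
  tangent_coord c (X (chart_inv c x)).

Lemma field_coord_chart c (X : vector_field M) p : chart_dom c p ->
  field_coord c X (chart_map c p) = tangent_coord c (X p).
Proof. by move=> cp; rewrite /field_coord chart_mapK. Qed.

Lemma smooth_field_at (X : vector_field M) c p : smooth_field X -> chart_dom c p ->
  smooth_at (chart_map c p) (field_coord c X).
Proof.
move=> sX cp; apply: smooth_on_smooth_at (sX c) (chart_img cp).
exact: chart_img_open.
Qed.

(** The components in [c] are the differential of the transition from [d] applied to the components
    in [d], read through the transition from [c]. *)
Lemma smooth_fieldP (X : vector_field M) :
  (forall p, exists2 c, chart_dom c p &
     smooth_at (chart_map c p) (field_coord c X)) -> smooth_field X.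
Proof.
move=> sX c; apply: smooth_at_smooth_on => _ [p cp <-].
have [d dp sd] := sX p.
have st := smooth_at_transition cp dp.
have s1 : smooth_at (chart_map d p) (fun y =>
    'd (chart_map c \o chart_inv d) y (field_coord d X y)).
  by apply: smooth_at_diff => //; exact: smooth_at_transition.
have := smooth_at_comp st (g := fun y =>
    'd (chart_map c \o chart_inv d) y (field_coord d X y)).
rewrite /= chart_mapK// => /(_ s1); apply: smooth_at_ext.
near=> x; rewrite /field_coord.
have cx : chart_dom c (chart_inv c x).
  by near: x; apply: near_chart_inv => //; exact: near_dom.
have dx : chart_dom d (chart_inv c x).
  by near: x; apply: near_chart_inv => //; exact: near_dom.
by rewrite chart_mapK// -tangent_coord_change.
Unshelve. all: by end_near. Qed.

End charts.

(** * Cutoff functions on a manifold *)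

Section cutoff.
Variables (R : realType) (n : nat) (M : smoothManifold R n).
Implicit Types (c d : chart M) (p q : M).

(** The last clause says that the support of [b] lies in [N]. It is phrased as a dichotomy because
    this is how products are glued: around a point of [N] both factors are smooth, around any other
    point the product is locally 0. *)
Lemma cutoff_exists p (N : set M) : open N -> N p ->
  exists b : M -> R, [/\ smooth_function b, \forall q \near p, b q = 1 &
    forall q, N q \/ \forall q' \near q, b q' = 0].
Proof.
move=> oN Np; pose c := chart_at p; have cp : chart_dom c p := chart_at_dom p.
pose a := chart_map c p.
have [r r0 ball_r] : exists2 r : R, 0 < r &
    ball a r `<=` chart_map c @` (chart_dom c `&` N).
  apply/nbhs_ballP; apply: open_nbhs_nbhs; split; last by exists p.
  exact: open_chart_image.
have r20 : 0 < r / 2 by rewrite divr_gt0.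
(* Half the radius, so that the closed ball [K0] still lies in the chart image of [N]. *)
have [b [sb b1 b0]] := bump_exists a r20.
pose K0 := [set x : 'rV[R]_n | `|x - a| <= r / 2].
have K0ball : K0 `<=` ball a r.
  move=> x; rewrite /K0 /= -ball_normE /ball_ /= distrC => /le_lt_trans; apply.
  by rewrite ltr_pdivrMr// ltr_pMr// ltr1n.
have cK0 : compact K0.
  apply: bounded_closed_compact.
    exists (`|a| + r / 2); split; first exact: num_real.
    move=> s rs x /= xK; rewrite -(subrK a x) ltW//.
    apply: le_lt_trans rs; rewrite (le_trans (ler_normD _ _))// addrC lerD2l//.
  have -> : K0 = (fun x => `|x - a|) @^-1` [set y : R | y <= r / 2] by [].
  apply: closed_comp; last exact: closed_le.
  move=> x _.
  have cx := smooth_at_continuous (smooth_atB (smooth_at_id x) (smooth_at_cst x a)).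
  exact: (cvg_norm cx).
pose K := chart_inv c @` K0.
have KN : K `<=` chart_dom c `&` N.
  by move=> _ [x /K0ball/ball_r[q [cq Nq] <-] <-]; rewrite chart_mapK.
(* [K] is compact, and closed because the manifold is Hausdorff. Without this, the bump extended by
   0 could fail to be continuous at points outside the chart. *)
have clK : closed K.
  apply: compact_closed; first exact: manifold_hausdorff.
  apply: continuous_compact cK0; apply: continuous_in_subspaceT => x /set_mem xK.
  apply: chart_inv_continuous; have [q [cq _] qx] := ball_r _ (K0ball _ xK).
  by exists q.
have notK q : ~ K q -> \forall q' \near q, ~ K q'.
  by move=> Kq; apply: open_nbhs_nbhs; split => //; exact: closed_openC.
pose beta q := if `[< K q >] then b (chart_map c q) else 0.
have betaE q : chart_dom c q -> beta q = b (chart_map c q).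
  move=> cq; rewrite /beta; case: asboolP => // Kq; rewrite b0// ltNge.
  by apply/negP => qK; apply: Kq; exists (chart_map c q) => //; rewrite chart_mapK.
have beta0 q : ~ K q -> \forall q' \near q, beta q' = 0.
  by move=> /notK; apply: filterS => q' Kq'; rewrite /beta; case: asboolP.
exists beta; split.
- apply: smooth_functionP => q; have [Kq|Kq] := pselect (K q).
    have [cq Nq] := KN _ Kq; exists c => //; apply: smooth_at_ext (sb _).
    near=> x; have xi : (chart_map c @` chart_dom c) x.
      by near: x; exact: near_img.
    by rewrite /= betaE ?chart_invK//; exact: chart_inv_dom.
  exists (chart_at q); first exact: chart_at_dom.
  apply: smooth_at_ext (smooth_at_cst _ 0); near=> x; apply/esym.
  by near: x; exact: (near_chart_inv (chart_at_dom q) (beta0 q Kq)).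
- near=> q; rewrite betaE; last by near: q; exact: near_dom.
  by near: q; exact: (near_chart_map cp b1).
- move=> q; have [/KN[_ ?]|/beta0 ?] := pselect (K q); [by left|by right].
Unshelve. all: by end_near. Qed.

Lemma smooth_function_cutoff (N : set M) (b g : M -> R) : smooth_function b ->
  (forall q, N q \/ \forall q' \near q, b q' = 0) ->
  (forall q, N q -> exists2 c, chart_dom c q &
     smooth_at (chart_map c q) (g \o chart_inv c)) ->
  smooth_function (fun q => b q * g q).
Proof.
move=> sb Nb sg; apply: smooth_functionP => q; have [Nq|b0] := Nb q.
  have [c cq sgq] := sg q Nq; exists c => //.
  by apply: smooth_atM sgq; exact: smooth_function_at.
exists (chart_at q); first exact: chart_at_dom.
apply: smooth_at_ext (smooth_at_cst _ 0); near=> x; apply/esym.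
rewrite /=; suff -> : b (chart_inv (chart_at q) x) = 0 by rewrite mul0r.
by near: x; exact: (near_chart_inv (chart_at_dom q) b0).
Unshelve. all: by end_near. Qed.

Lemma smooth_field_cutoff (N : set M) (b : M -> R) (X : vector_field M) :
  smooth_function b ->
  (forall q, N q \/ \forall q' \near q, b q' = 0) ->
  (forall q, N q -> exists2 c, chart_dom c q &
     smooth_at (chart_map c q) (field_coord c X)) ->
  smooth_field (fun q => b q *: X q).
Proof.
move=> sb Nb sX; apply: smooth_fieldP => q.
have [Nq|b0] := Nb q.
  have [c cq sXq] := sX q Nq; exists c => //.
  apply: smooth_at_ext (smooth_atZ (smooth_function_at sb cq) sXq).
  by near=> x; rewrite /field_coord tangent_coordZ.
exists (chart_at q); first exact: chart_at_dom.
apply: smooth_at_ext (smooth_at_cst _ 0); near=> x; apply/esym.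
rewrite /field_coord tangent_coordZ.
suff -> : b (chart_inv (chart_at q) x) = 0 by rewrite scale0r.
by near: x; exact: (near_chart_inv (chart_at_dom q) b0).
Unshelve. all: by end_near. Qed.

End cutoff.

(** * Product and chain rules, second derivatives *)

Section derivation_rules.
Variable R : realType.
Implicit Types V W : normedModType R.

Lemma is_derive_scale V n (x v : V) (a : V -> R) (f : V -> 'rV[R]_n) da df :
  is_derive x v a da -> is_derive x v f df ->
  is_derive x v (fun y => a y *: f y) (da *: f x + a x *: df).
Proof.
move=> [da1 daE] [df1 dfE].
have fi i : derivable (fun y => f y 0 i) x v by move/derivable_mxP : df1; exact.
have afE j : is_derive x v (fun y => (a y *: f y) 0 j) ((da *: f x + a x *: df) 0 j).
  have -> : (fun y => (a y *: f y) 0 j) = a * (fun y => f y 0 j).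
    by apply/funext => y; rewrite mxE.
  apply: is_derive_eq (is_deriveM (derivableP da1) (derivableP (fi j))) _.
  rewrite daE -dfE (derive_mx df1) !mxE /GRing.scale /= addrC.
  by congr (_ + _); rewrite mulrC.
have d : derivable (fun y => a y *: f y) x v.
  by apply/derivable_mxP => i j; rewrite ord1; case: (afE j).
apply: DeriveDef => //; rewrite (derive_mx d).
by apply/matrixP => i j; rewrite ord1 mxE; case: (afE j).
Qed.

Lemma is_derive_bigsum V W n (x v : V) (f : 'I_n -> V -> W) df :
  (forall i, is_derive x v (f i) (df i)) ->
  is_derive x v (fun y => \sum_i f i y) (\sum_i df i).
Proof.
move=> fd; have -> : (fun y => \sum_i f i y) = \sum_i f i.
  by apply/funext => y; rewrite fct_sumE.
exact: is_derive_sum.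
Qed.

Lemma is_derive_diff_comp V W W' (x v : V) (f : V -> W) (g : W -> W') :
  differentiable f x -> differentiable g (f x) ->
  is_derive x v (fun y => g (f y)) ('d g (f x) ('D_v f x)).
Proof.
move=> df dg; have dgf := differentiable_comp df dg.
apply: DeriveDef; first exact: diff_derivable.
have E1 := deriveE v dgf; have E2 := congr1 (fun h : _ -> _ => h v) (diff_comp df dg).
by rewrite (deriveE v df); exact: etrans E1 E2.
Qed.

Lemma diff_coord V n (f : V -> 'rV[R]_n) (x v : V) i : differentiable f x ->
  'd (fun y => f y 0 i) x v = 'd f x v 0 i.
Proof.
move=> df; have dfi : differentiable (fun y => f y 0 i) x.
  exact: (differentiable_comp df (differentiable_coord _ _ _)).
rewrite -(deriveE v dfi) -(deriveE v df) (derive_mx (diff_derivable df)) mxE.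
by [].
Qed.

(** The order of the arguments matters: [w] is the direction of the inner derivative, frozen before
    differentiating along [u]. *)
Definition hess n p (f : 'rV[R]_n -> 'rV[R]_p) (x u w : 'rV[R]_n) : 'rV[R]_p :=
  \sum_i w 0 i *: 'd ('D_(delta_mx 0 i) f) x u.

Lemma hessDl n p (f : 'rV[R]_n -> 'rV[R]_p) x u u' w :
  hess f x (u + u') w = hess f x u w + hess f x u' w.
Proof.
by rewrite -big_split; apply: eq_bigr => i _; rewrite linearD scalerDr.
Qed.

Lemma hessDr n p (f : 'rV[R]_n -> 'rV[R]_p) x u w w' :
  hess f x u (w + w') = hess f x u w + hess f x u w'.
Proof. by rewrite -big_split; apply: eq_bigr => i _; rewrite mxE scalerDl. Qed.

(** Base point and direction both depend on [y]. Two uses are intended: the velocity along a curve,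
    and a vector field, where [x] is the identity. *)
Lemma is_derive_diff V n p (y v : V) (f : 'rV[R]_n -> 'rV[R]_p)
    (x z : V -> 'rV[R]_n) : smooth_at (x y) f -> differentiable x y ->
  derivable z y v ->
  is_derive y v (fun y' => 'd f (x y') (z y'))
    ('d f (x y) ('D_v z y) + hess f (x y) ('D_v x y) (z y)).
Proof.
move=> sf dx dz.
have dzi i : derivable (fun y' => z y' 0 i) y v by move/derivable_mxP : dz; exact.
have D := is_derive_bigsum (fun i => is_derive_scale (derivableP (dzi i))
  (is_derive_diff_comp v dx
    (smooth_at_differentiable (smooth_at_derive (delta_mx 0 i) sf)))).
have nx : \forall y' \near y, smooth_at (x y') f.
  exact: (differentiable_continuous dx (smooth_at_near sf)).
have E : \forall y' \near y, \sum_i z y' 0 i *: 'D_(delta_mx 0 i) f (x y') =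
    'd f (x y') (z y').
  near=> y'; rewrite -diff_sum_delta//; apply: smooth_at_differentiable.
  by near: y'; exact: nx.
apply: is_derive_eq (near_eq_is_derive E D) _.
rewrite big_split /=; congr (_ + _).
rewrite (diff_sum_delta _ (smooth_at_differentiable sf)); apply: eq_bigr => i _.
by rewrite (derive_mx dz) mxE.
Unshelve. all: by end_near. Qed.

End derivation_rules.

(** * Connections in coordinates *)

Section fields.
Variables (R : realType) (n : nat) (M : smoothManifold R n).
Implicit Types (c d : chart M) (p q : M) (X Y : vector_field M).

Lemma smooth_function_cst (a : R) : smooth_function (fun _ : M => a).
Proof.
by apply: smooth_functionP => p; exists (chart_at p);
  [exact: chart_at_dom|exact: smooth_at_cst].
Qed.

Lemma smooth_functionM (f g : M -> R) : smooth_function f -> smooth_function g ->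
  smooth_function (fun q => f q * g q).
Proof.
move=> sf sg; apply: smooth_functionP => p; exists (chart_at p).
  exact: chart_at_dom.
by apply: smooth_atM; apply: smooth_function_at => //; exact: chart_at_dom.
Qed.

Lemma smooth_field0 : smooth_field (fun p : M => 0 : tangent p).
Proof.
apply: smooth_fieldP => p; exists (chart_at p); first exact: chart_at_dom.
apply: smooth_at_ext (smooth_at_cst _ 0); near=> x.
by rewrite /field_coord tangent_coord0.
Unshelve. all: by end_near. Qed.

Lemma smooth_fieldD X Y : smooth_field X -> smooth_field Y ->
  smooth_field (fun q => X q + Y q).
Proof.
move=> sX sY; apply: smooth_fieldP => p; exists (chart_at p).
  exact: chart_at_dom.
apply: smooth_at_ext (smooth_atD (smooth_field_at sX (chart_at_dom p))
                                 (smooth_field_at sY (chart_at_dom p))).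
by near=> x; rewrite /field_coord tangent_coordD.
Unshelve. all: by end_near. Qed.

Lemma smooth_fieldB X Y : smooth_field X -> smooth_field Y ->
  smooth_field (fun q => X q - Y q).
Proof.
move=> sX sY; apply: smooth_fieldP => p; exists (chart_at p).
  exact: chart_at_dom.
apply: smooth_at_ext (smooth_atB (smooth_field_at sX (chart_at_dom p))
                                 (smooth_field_at sY (chart_at_dom p))).
by near=> x; rewrite /field_coord tangent_coordB.
Unshelve. all: by end_near. Qed.

Lemma smooth_fieldZ (f : M -> R) X : smooth_function f -> smooth_field X ->
  smooth_field (fun q => f q *: X q).
Proof.
move=> sf sX; apply: smooth_fieldP => p; exists (chart_at p).
  exact: chart_at_dom.
apply: smooth_at_ext (smooth_atZ (smooth_function_at sf (chart_at_dom p))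
                                 (smooth_field_at sX (chart_at_dom p))).
by near=> x; rewrite /field_coord tangent_coordZ.
Unshelve. all: by end_near. Qed.

Lemma smooth_field_sum I (r : seq I) (X : I -> vector_field M) :
  (forall i, smooth_field (X i)) ->
  smooth_field (fun q => \sum_(i <- r) X i q).
Proof.
move=> sX; elim: r => [|i r IH].
  rewrite (_ : (fun q => _) = (fun q => 0)); first exact: smooth_field0.
  by apply/functional_extensionality_dep => q; rewrite big_nil.
rewrite (_ : (fun q => _) = (fun q => X i q + \sum_(j <- r) X j q)).
  exact: smooth_fieldD.
by apply/functional_extensionality_dep => q; rewrite big_cons.
Qed.

(** The field with constant components [w] exists only on the chart domain; the factor [b] erases
    the meaningless values of [tangent_of] outside. *)
Definition coord_field (b : M -> R) c (w : 'rV[R]_n) : vector_field M :=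
  fun q => b q *: tangent_of c q w.

Lemma frame_exists c p : chart_dom c p -> exists b : M -> R,
  [/\ smooth_function b, \forall q \near p, b q = 1,
      forall q, b q != 0 -> chart_dom c q,
      forall w, smooth_field (coord_field b c w) &
      forall X i, smooth_field X ->
        smooth_function (fun q => b q * tangent_coord c (X q) 0 i)].
Proof.
move=> cp.
have [b [sb b1 Nb]] := cutoff_exists (chart_dom_open c) cp.
exists b; split => //.
- move=> q bq; have [//|/nbhs_singleton b0] := Nb q.
  by rewrite b0 eqxx in bq.
- move=> w; apply: smooth_field_cutoff sb Nb _ => q cq; exists c => //.
  apply: smooth_at_ext (smooth_at_cst _ w); near=> x.
  rewrite /field_coord tangent_ofK//; apply: chart_inv_dom.
  by near: x; exact: near_img.
- move=> X i sX; apply: smooth_function_cutoff sb Nb _ => q cq; exists c => //.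
  exact: (smooth_at_coord i (smooth_field_at sX cq)).
Unshelve. all: by end_near. Qed.

Lemma extension_exists p (v : tangent p) :
  exists E : vector_field M, smooth_field E /\ E p = v.
Proof.
have cp := chart_at_dom p; have [b [_ b1 _ sF _]] := frame_exists cp.
exists (coord_field b (chart_at p) (tangent_coord (chart_at p) v)); split => //.
by rewrite /coord_field (nbhs_singleton b1) scale1r tangent_coordK.
Qed.

Lemma extensionP p (v : tangent p) :
  smooth_field (extension v) /\ extension v p = v.
Proof. exact: (@xgetPex _ _ _ (extension_exists v)). Qed.

(** The square is there because coefficients and frame fields each need one factor [b] to become
    global. *)
Lemma frame_decomp (b : M -> R) c X : (forall q, b q != 0 -> chart_dom c q) ->
  (fun q => (b q * b q) *: X q) =
  (fun q => \sum_i (b q * tangent_coord c (X q) 0 i) *: coord_field b c (delta_mx 0 i) q).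
Proof.
move=> bc; apply/functional_extensionality_dep => q.
have [b0|/bc cq] := eqVneq (b q) 0.
  rewrite b0 mul0r scale0r big1// => i _; by rewrite mul0r scale0r.
apply: (tangent_coord_inj cq).
rewrite tangent_coordZ tangent_coord_sum.
rewrite [in LHS](row_sum_delta (tangent_coord c (X q))) scaler_sumr.
apply: eq_bigr => i _.
by rewrite !tangent_coordZ tangent_ofK// !scalerA mulrAC.
Qed.

End fields.

Section connections.
Variables (R : realType) (n : nat) (M : smoothManifold R n).
Variable nabla : affineConnection M.
Implicit Types (c d : chart M) (p q : M) (X Y : vector_field M).

Lemma eq_conn X X' Y Y' p : (forall q, X q = X' q) -> (forall q, Y q = Y' q) ->
  nabla X Y p = nabla X' Y' p.
Proof.
move=> XX YY; have -> : X = X' by exact: functional_extensionality_dep.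
by have -> : Y = Y' by exact: functional_extensionality_dep.
Qed.

Lemma conn0l Y p : smooth_field Y -> nabla (fun q => 0) Y p = 0.
Proof.
move=> sY; have s0 := @smooth_field0 R n M.
have := conn_linear_l nabla (@smooth_function_cst R n M 1) s0 s0 sY p.
have -> : (fun q : M => 1 *: (0 : tangent q) + 0) = (fun q => 0).
  by apply/functional_extensionality_dep => q; rewrite scaler0 addr0.
by rewrite scale1r -[LHS]addr0 => /addrI.
Qed.

Lemma conn_suml I (r : seq I) (f : I -> M -> R) (X : I -> vector_field M) Y p :
  (forall i, smooth_function (f i)) -> (forall i, smooth_field (X i)) ->
  smooth_field Y ->
  nabla (fun q => \sum_(i <- r) f i q *: X i q) Y p =
  \sum_(i <- r) f i p *: nabla (X i) Y p.
Proof.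
move=> sf sX sY; elim: r => [|i r IH].
  by rewrite big_nil; apply: etrans (conn0l p sY); apply: eq_conn => // q; rewrite big_nil.
rewrite big_cons -IH -conn_linear_l//.
  by apply: eq_conn => // q; rewrite big_cons.
by apply: smooth_field_sum => j; exact: smooth_fieldZ.
Qed.

Lemma conn0r X p : smooth_field X -> nabla X (fun q => 0) p = 0.
Proof.
move=> sX; have s0 := @smooth_field0 R n M.
have := conn_additive_r nabla sX s0 s0 p.
have -> : (fun q : M => (0 : tangent q) + 0) = (fun q => 0).
  by apply/functional_extensionality_dep => q; rewrite addr0.
by rewrite -[LHS]addr0 => /addrI.
Qed.

Lemma conn_sumr I (r : seq I) (f : I -> M -> R) (Y : I -> vector_field M) X p :
  (forall i, smooth_function (f i)) -> (forall i, smooth_field (Y i)) ->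
  smooth_field X ->
  nabla X (fun q => \sum_(i <- r) f i q *: Y i q) p =
  \sum_(i <- r) (dfunction (f i) (X p) *: Y i p + f i p *: nabla X (Y i) p).
Proof.
move=> sf sY sX; elim: r => [|i r IH].
  by rewrite big_nil; apply: etrans (conn0r p sX); apply: eq_conn => // q; rewrite big_nil.
rewrite big_cons -IH -conn_leibniz// -conn_additive_r//.
- by apply: eq_conn => // q; rewrite big_cons.
- exact: smooth_fieldZ.
by apply: smooth_field_sum => j; exact: smooth_fieldZ.
Qed.

Definition bilinear_map k l (G : 'rV[R]_k -> 'rV[R]_k -> 'rV[R]_l) : Prop :=
  [/\ forall u v w, G (u + v) w = G u w + G v w,
      forall u v w, G u (v + w) = G u v + G u w &
      forall u a v, G u (a *: v) = a *: G u v].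

(** The symbols at the single point [p], as a bilinear map whose first slot is the direction of
    differentiation, characterised by the coordinate formula for global fields. *)
Definition christoffel c p (G : 'rV[R]_n -> 'rV[R]_n -> 'rV[R]_n) : Prop :=
  (bilinear_map G) /\
  forall X Y, smooth_field X -> smooth_field Y ->
    tangent_coord c (nabla X Y p) =
    'd (field_coord c Y) (chart_map c p) (tangent_coord c (X p)) +
    G (tangent_coord c (X p)) (tangent_coord c (Y p)).

Lemma christoffel_exists c p : chart_dom c p -> exists G, christoffel c p G.
Proof.
move=> cp; have [b [sb b1 bc sF sC]] := frame_exists cp.
have bp : b p = 1 := nbhs_singleton b1.
pose F i := coord_field b c (delta_mx 0 i).
have sFi i : smooth_field (F i) := sF _.
exists (fun u v => \sum_j v 0 j *: \sum_i u 0 i *: tangent_coord c (nabla (F i) (F j) p)).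
split; [split|].
- move=> u v w; rewrite -big_split; apply: eq_bigr => j _ /=.
  rewrite -scalerDr -big_split; congr (_ *: _); apply: eq_bigr => i _.
  by rewrite mxE scalerDl.
- move=> u v w; rewrite -big_split; apply: eq_bigr => j _ /=.
  by rewrite mxE scalerDl.
- move=> u a v; rewrite scaler_sumr; apply: eq_bigr => j _ /=.
  by rewrite mxE scalerA.
move=> X Y sX sY.
have sbb := smooth_functionM sb sb.
(* Since [b p = 1], replacing [X] by [b^2 X] leaves the value at [p] unchanged, and [b^2 X] is a
   combination of global frame fields. *)
have tensor Z : smooth_field Z -> nabla X Z p =
    \sum_i tangent_coord c (X p) 0 i *: nabla (F i) Z p.
  move=> sZ.
  have := conn_linear_l nabla sbb sX (@smooth_field0 R n M) sZ p.
  rewrite conn0l// addr0 bp mulr1 scale1r => <-.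
  have -> : (fun q => (b q * b q) *: X q + 0) = (fun q => (b q * b q) *: X q).
    by apply/functional_extensionality_dep => q; rewrite addr0.
  rewrite (frame_decomp X bc) conn_suml// => [|i]; last exact: sC.
  by apply: eq_bigr => i _; rewrite bp mul1r.
(* Only globally smooth fields may be fed to [nabla]: since [b = 1] near [p],
   [Y] is replaced by [b^2 Y = \sum_j (b Y^j) (b e_j)]. *)
have := conn_leibniz nabla sbb sX sY p.
(* [b^2] is constant near [p], so the Leibniz rule adds no term. *)
have dbb : dfunction (fun q => b q * b q) (X p) = 0.
  have e : \forall x \near chart_map c p,
      ((fun q => b q * b q) \o chart_inv c) x = cst 1 x.
    near=> x; rewrite /= (_ : b _ = 1) ?mulr1//.
    by near: x; exact: (near_chart_inv cp b1).
  have dbc := smooth_at_differentiable (smooth_function_at sbb cp).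
  rewrite (dfunction_coord _ cp dbc).
  exact: etrans (congr1 (fun g : _ -> _ => g _) (near_eq_diff e dbc))
                (congr1 (fun g : _ -> _ => g _) (diff_cst (1:R) (chart_map c p))).
rewrite dbb scale0r add0r bp mulr1 scale1r => <-.
rewrite (frame_decomp Y bc) conn_sumr// => [|i]; last exact: sC.
rewrite tangent_coord_sum.
have dY : differentiable (field_coord c Y) (chart_map c p).
  exact: smooth_at_differentiable (smooth_field_at sY cp).
rewrite [X in _ = X + _]row_sum_delta -big_split /=; apply: eq_bigr => j _.
rewrite tangent_coordD !tangent_coordZ tangent_ofK// bp mul1r scale1r; congr (_ *: _ + _ *: _).
  have dC := smooth_at_differentiable (smooth_function_at (sC _ j sY) cp).
  rewrite (dfunction_coord _ cp dC).
  have e : \forall x \near chart_map c p,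
      ((fun q => b q * tangent_coord c (Y q) 0 j) \o chart_inv c) x =
      field_coord c Y x 0 j.
    near=> x; rewrite /= (_ : b _ = 1) ?mul1r//.
    by near: x; exact: (near_chart_inv cp b1).
  exact: etrans (congr1 (fun g : _ -> _ => g _) (near_eq_diff e dC))
    (diff_coord _ _ dY).
rewrite tensor// tangent_coord_sum; apply: eq_bigr => i _.
by rewrite tangent_coordZ.
Unshelve. all: by end_near. Qed.

End connections.

(** * Curves and covariant derivatives *)

Section curves.
Variables (R : realType) (n : nat) (M : smoothManifold R n).
Variables (I : set R) (s : R -> M).
Hypotheses (I_open : open I) (s_smooth : smooth_curve I s).
Implicit Types (c d : chart M) (t : R).

Lemma curve_near t (P : M -> Prop) : I t -> (\forall q \near s t, P q) ->
  \forall r \near t, P (s r).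
Proof. by move=> It; exact: (s_smooth.1 t It). Qed.

Lemma smooth_curve_dom_open (A : set M) : open A -> open (I `&` s @^-1` A).
Proof.
move=> oA; rewrite openE => t [It At]; rewrite /interior.
have nI : \forall r \near t, I r by exact: open_nbhs_nbhs.
have nA : \forall r \near t, A (s r) by apply: (curve_near It); exact: open_nbhs_nbhs.
by near=> r; split; near: r.
Unshelve. all: by end_near. Qed.

Lemma smooth_curve_at c t : I t -> chart_dom c (s t) ->
  smooth_at t (chart_map c \o s).
Proof.
move=> It ct; apply: smooth_on_smooth_at (s_smooth.2 c) _; last by [].
exact/smooth_curve_dom_open/chart_dom_open.
Qed.

Lemma velocity_coord c t : I t -> chart_dom c (s t) ->
  tangent_coord c (velocity s t) = 'D_1 (chart_map c \o s) t.
Proof.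
move=> It ct; have ap := chart_at_dom (s t).
have dx := smooth_at_differentiable (smooth_curve_at It ap).
have dt := smooth_at_differentiable (smooth_at_transition ap ct).
have D := is_derive_diff_comp (1:R) dx dt.
have e : \forall r \near t, (chart_map c \o chart_inv (chart_at (s t)))
    ((chart_map (chart_at (s t)) \o s) r) = (chart_map c \o s) r.
  have := curve_near It (near_dom ap); apply: filterS => r rp.
  by rewrite /= chart_mapK.
have [_ D2] := near_eq_is_derive e D.
exact: esym D2.
Qed.

End curves.

Section covariant_derivative.
Variables (R : realType) (n : nat) (M : smoothManifold R n).
Variables (nabla : affineConnection M) (I : set R) (s : R -> M).
Hypotheses (I_open : open I) (s_smooth : smooth_curve I s).
Implicit Types (c : chart M) (t : R).

(** The right-hand side involves only [V] and the curve, so the value [w] is the same for every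
    decomposition allowed by the definition. *)
Lemma covariant_derivative_coord (V : forall t, tangent (s t)) c t (w : tangent (s t)) G :
  I t -> chart_dom c (s t) -> christoffel nabla c (s t) G ->
  is_covariant_derivative nabla V (t := t) w ->
  tangent_coord c w = 'D_1 (fun r => tangent_coord c (V r)) t +
    G (tangent_coord c (velocity s t)) (tangent_coord c (V t)).
Proof.
move=> It ct [[GDl GDr GZ] GE] [k [a [E [sE da VE ->]]]].
pose v := tangent_coord c (velocity s t).
have dx := smooth_at_differentiable (smooth_curve_at I_open s_smooth It ct).
have dE i := smooth_at_differentiable (smooth_field_at (sE i) ct).
have D := is_derive_bigsum (fun i => is_derive_scale (derivableP (da i))
  (is_derive_diff_comp (1:R) dx (dE i))).
have e : \forall r \near t, \sum_i a i r *: field_coord c (E i) ((chart_map c \o s) r)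
     = tangent_coord c (V r).
  have nd := curve_near s_smooth It (near_dom ct).
  near=> r; have rc : chart_dom c (s r) by near: r.
  have -> : V r = \sum_(i < k) a i r *: E i (s r) by near: r.
  rewrite tangent_coord_sum; apply: eq_bigr => i _.
  by rewrite field_coord_chart// -tangent_coordZ.
have [_ ->] := near_eq_is_derive e D.
have -> : V t = \sum_(i < k) a i t *: E i (s t) by exact: nbhs_singleton VE.
have Gv0 : G v 0 = 0 by apply: (addrI (G v 0)); rewrite -GDr !addr0.
have Gsum : G v (tangent_coord c (\sum_(i < k) a i t *: E i (s t))) =
    \sum_(i < k) a i t *: G v (tangent_coord c (E i (s t))).
  rewrite tangent_coord_sum (big_morph (G v) (GDr v) Gv0); apply: eq_bigr => i _.
  by rewrite tangent_coordZ GZ.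
rewrite Gsum -big_split tangent_coord_sum; apply: eq_bigr => i _ /=.
rewrite tangent_coordD !tangent_coordZ /conn_at.
have [sX Xv] := extensionP (velocity s t).
rewrite GE// Xv field_coord_chart// scalerDr addrA.
by rewrite -(velocity_coord I_open s_smooth It ct).
Unshelve. all: by end_near. Qed.

(** The components of [V] serve as coefficients along the coordinate fields, cut off by a function
    equal to 1 around [s t]. To prove that 0 is a covariant derivative, one exhibits some [w] and
    then computes that it vanishes. *)
Lemma covariant_derivative_exists (V : forall t, tangent (s t)) c t :
  I t -> chart_dom c (s t) ->
  derivable (fun r => tangent_coord c (V r)) t 1 ->
  exists w : tangent (s t), is_covariant_derivative nabla V (t := t) w.
Proof.
move=> It ct dV; have [b [sb b1 bc sF _]] := frame_exists ct.
eexists; exists n, (fun i r => tangent_coord c (V r) 0 i),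
  (fun i => coord_field b c (delta_mx 0 i)); split => //.
- by move=> i; move/derivable_mxP : dV; exact.
- have nd := curve_near s_smooth It (near_dom ct).
  have nb := curve_near s_smooth It b1.
  near=> r; have rc : chart_dom c (s r) by near: r.
  apply: (tangent_coord_inj rc); rewrite tangent_coord_sum.
  rewrite [LHS](row_sum_delta (tangent_coord c (V r))); apply: eq_bigr => i _.
  rewrite tangent_coordZ /coord_field (_ : b _ = 1) ?scale1r ?tangent_ofK//.
  by near: r.
Unshelve. all: by end_near. Qed.

End covariant_derivative.

(** * Smooth maps and images of curves *)

Section maps.
Variables (R : realType) (m n : nat).
Variables (M : smoothManifold R m) (N : smoothManifold R n) (F : M -> N).
Hypothesis F_smooth : smooth_map F.
Implicit Types (c : chart M) (d : chart N) (p : M).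

Lemma smooth_map_at c d p : chart_dom c p -> chart_dom d (F p) ->
  smooth_at (chart_map c p) (chart_map d \o F \o chart_inv c).
Proof.
move=> cp dp; apply: smooth_on_smooth_at (F_smooth.2 c d) _; last by exists p.
apply: open_chart_image; apply: open_comp; last exact: chart_dom_open.
by move=> q _; exact: F_smooth.1.
Qed.

Lemma tangent_map_coord c d p (v : tangent p) :
  chart_dom c p -> chart_dom d (F p) ->
  tangent_coord d (tangent_map F v) =
  'd (chart_map d \o F \o chart_inv c) (chart_map c p) (tangent_coord c v).
Proof.
move=> cp dp; have cp' := chart_at_dom p; have dp' := chart_at_dom (F p).
pose c' := chart_at p; pose d' := chart_at (F p).
have df := smooth_at_differentiable (smooth_map_at cp' dp').
have dd := smooth_at_differentiable (smooth_at_transition dp' dp).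
have q : (chart_map d' \o F \o chart_inv c') (chart_map c' p) = chart_map d' (F p).
  by rewrite /= chart_mapK.
have dd' : differentiable (chart_map d \o chart_inv d')
    ((chart_map d' \o F \o chart_inv c') (chart_map c' p)) by rewrite q.
have e : \forall x \near chart_map c' p,
    ((chart_map d \o chart_inv d') \o (chart_map d' \o F \o chart_inv c')) x =
    ((chart_map d \o F) \o chart_inv c') x.
  have nd : \forall q \near p, chart_dom d' (F q) by apply: F_smooth.1; exact: near_dom.
  have := near_chart_inv cp' nd; apply: filterS => x xd.
  by rewrite /= chart_mapK.
have E1 := congr1 (fun g : _ -> _ => g v) (near_eq_diff e (differentiable_comp df dd')).
have E2 := congr1 (fun g : _ -> _ => g v) (diff_comp df dd').
have E3 := congr1 (fun x => 'd (chart_map d \o chart_inv d') x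
  ('d (chart_map d' \o F \o chart_inv c') (chart_map c' p) v)) q.
have dfc := smooth_at_differentiable (smooth_map_at cp dp).
have E4 := diff_chart v cp' cp dfc.
exact: etrans (esym E3) (etrans (esym E2) (etrans E1 E4)).
Qed.

Lemma tangent_mapD p (u v : tangent p) :
  tangent_map F (u + v) = tangent_map F u + tangent_map F v.
Proof. by rewrite /tangent_map; exact: linearD. Qed.

Lemma tangent_mapB p (u v : tangent p) :
  tangent_map F (u - v) = tangent_map F u - tangent_map F v.
Proof. by rewrite /tangent_map; exact: linearB. Qed.

Lemma tangent_mapZ p a (u : tangent p) :
  tangent_map F (a *: u) = a *: tangent_map F u.
Proof. by rewrite /tangent_map; exact: linearZZ. Qed.

Variables (I : set R) (s : R -> M).
Hypotheses (I_open : open I) (s_smooth : smooth_curve I s).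

Lemma map_curve_near c d t : I t -> chart_dom c (s t) -> chart_dom d (F (s t)) ->
  \forall r \near t, [/\ I r, chart_dom c (s r) & chart_dom d (F (s r))].
Proof.
move=> It ct dt.
have n1 : \forall r \near t, I r by exact: open_nbhs_nbhs.
have n2 := curve_near s_smooth It (near_dom ct).
have nF : \forall q \near s t, chart_dom d (F q) by apply: F_smooth.1; exact: near_dom.
have n3 := curve_near s_smooth It nF.
by near=> r; split; near: r.
Unshelve. all: by end_near. Qed.

Lemma map_curve_coord c d t : I t -> chart_dom c (s t) -> chart_dom d (F (s t)) ->
  \forall r \near t, (chart_map d \o F \o chart_inv c) ((chart_map c \o s) r) =
    (chart_map d \o (F \o s)) r.
Proof.
move=> It ct dt; have := map_curve_near It ct dt; apply: filterS => r [_ cr _].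
by rewrite /= chart_mapK.
Qed.

Lemma smooth_map_curve : smooth_curve I (F \o s).
Proof.
split=> [t It|d].
  by apply: continuous_comp; [exact: s_smooth.1|exact: F_smooth.1].
apply: smooth_at_smooth_on => t [It dt].
have ct := chart_at_dom (s t).
apply: smooth_at_ext (map_curve_coord It ct dt) _.
apply: (smooth_at_comp (smooth_curve_at I_open s_smooth It ct)).
by apply: smooth_map_at.
Qed.

Lemma velocity_map t : I t -> velocity (F \o s) t = tangent_map F (velocity s t).
Proof.
move=> It; have ct := chart_at_dom (s t); have dt := chart_at_dom (F (s t)).
apply: (tangent_coord_inj dt).
rewrite (velocity_coord I_open smooth_map_curve It dt).
rewrite (tangent_map_coord _ ct dt) (velocity_coord I_open s_smooth It ct).
have dx := smooth_at_differentiable (smooth_curve_at I_open s_smooth It ct).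
have df := smooth_at_differentiable (smooth_map_at ct dt).
have [_ D] := near_eq_is_derive (map_curve_coord It ct dt) (is_derive_diff_comp (1:R) dx df).
exact: D.
Qed.

End maps.

(** * Horizontal lifts *)

Section metric_coordinates.
Variables (R : realType) (n : nat) (M : smoothManifold R n).
Variable g : riemannianMetric M.
Implicit Types (c : chart M) (p q : M).

Lemma metric_suml p I (r : seq I) (a : I -> R) (u : I -> tangent p) (v : tangent p) :
  g p (\sum_(i <- r) a i *: u i) v = \sum_(i <- r) a i * g p (u i) v.
Proof.
elim: r => [|i r IH]; last by rewrite !big_cons metric_linear IH.
rewrite !big_nil; have := metric_linear g 1 0 0 v.
by rewrite scaler0 addr0 mul1r -[LHS]addr0 => /addrI.
Qed.

Lemma metricDl p (u v w : tangent p) : g p (u + v) w = g p u w + g p v w.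
Proof. by rewrite -[u]scale1r metric_linear mul1r scale1r. Qed.

Lemma metric0l p (w : tangent p) : g p 0 w = 0.
Proof. by apply: (addrI (g p 0 w)); rewrite -metricDl !addr0. Qed.

Lemma metricNl p (u w : tangent p) : g p (- u) w = - g p u w.
Proof. by apply/eqP; rewrite -addr_eq0 -metricDl addNr metric0l. Qed.

Lemma metric_eq0 p (u : tangent p) : g p u u = 0 -> u = 0.
Proof. by move=> g0; apply/eqP/negP => /negP /(metric_pos g); rewrite g0 ltxx. Qed.

Lemma tangent_sum_delta c p (v : tangent p) : chart_dom c p ->
  v = \sum_i tangent_coord c v 0 i *: tangent_of c p (delta_mx 0 i).
Proof.
move=> cp; apply: (tangent_coord_inj cp); rewrite tangent_coord_sum.
rewrite [LHS](row_sum_delta (tangent_coord c v)); apply: eq_bigr => i _.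
by rewrite tangent_coordZ tangent_ofK.
Qed.

Definition gram c q : 'M[R]_n := \matrix_(i, j)
  g q (tangent_of c q (delta_mx 0 i)) (tangent_of c q (delta_mx 0 j)).

Lemma metric_coord c p (u v : tangent p) : chart_dom c p ->
  g p u v = (tangent_coord c u *m gram c p *m (tangent_coord c v)^T) 0 0.
Proof.
move=> cp; rewrite [in LHS](tangent_sum_delta u cp) metric_suml -mulmxA mxE.
apply: eq_bigr => i _; congr (_ * _).
rewrite Defs.metric_sym [in LHS](tangent_sum_delta v cp) metric_suml mxE.
by apply: eq_bigr => j _; rewrite Defs.metric_sym !mxE mulrC.
Qed.

(** [metric_smooth] concerns global fields, so the coordinate fields are cut off by a function equal
    to 1 near [p]. *)
Lemma smooth_at_gram c p i j : chart_dom c p ->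
  smooth_at (chart_map c p) (fun x => gram c (chart_inv c x) i j).
Proof.
move=> cp; have [b [sb b1 bc sF _]] := frame_exists cp.
have := smooth_function_at (metric_smooth g (sF (delta_mx 0 i)) (sF (delta_mx 0 j))) cp.
apply: smooth_at_ext; near=> x.
have bx : b (chart_inv c x) = 1 by near: x; exact: (near_chart_inv cp b1).
by rewrite /= /coord_field bx !scale1r mxE.
Unshelve. all: by end_near. Qed.

End metric_coordinates.

Section saddle_matrix.
Variables (R : realType) (m n : nat) (G : 'M[R]_m) (J : 'M[R]_(m, n)).

(* The Lagrange system of the minimal-norm solution of [v *m J = w] for the
   scalar product [G]. *)
Definition saddle : 'M[R]_(m + n) := block_mx G J (- J^T) 0.

(** A kernel vector [(v, l)] satisfies [vG = l J^T] and [vJ = 0]. Hence [v G v^T = l (vJ)^T = 0] and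
    [v = 0]. Writing [l = uJ] gives [l l^T = l J^T u^T = 0], so [l = 0]. *)
Lemma saddle_unit :
  (forall v : 'rV[R]_m, (v *m G *m v^T) 0 0 = 0 -> v = 0) ->
  (forall w : 'rV[R]_n, exists v, v *m J = w) -> saddle \in unitmx.
Proof.
move=> G0 Jsurj; rewrite -row_free_unit -kermx_eq0; apply/rowV0P => x.
move=> /sub_kermxP; rewrite -(hsubmxK x) /saddle mul_row_block.
move: (lsubmx x) (rsubmx x) => v l.
rewrite -[X in _ = X -> _](@row_mx0 _ _ m n) => /eq_row_mx[].
rewrite mulmx0 addr0 mulmxN => /eqP; rewrite subr_eq0 => /eqP vG vJ.
have v0 : v = 0.
  by apply: G0; rewrite vG -mulmxA -trmx_mul vJ trmx0 mulmx0 mxE.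
have l0 : l = 0.
  have [u uJ] := Jsurj l.
  have ll : l *m l^T = 0 by rewrite -{2}uJ trmx_mul mulmxA -vG v0 !mul0mx.
  apply/rowP => j; rewrite mxE; apply/eqP; rewrite -sqrf_eq0; apply/eqP.
  have /psumr_eq0P H : \sum_k (l 0 k) ^+ 2 = 0.
    have := congr1 (fun A : 'M[R]_1 => A 0 0) ll; rewrite !mxE => H0; rewrite -[RHS]H0.
    by apply: eq_bigr => k _; rewrite mxE expr2.
  by apply: H => // k _; exact: sqr_ge0.
by rewrite v0 l0 row_mx0.
Qed.

(** The discarded right block is the Lagrange multiplier. An inverse matrix is used because its
    entries are smooth in the data. *)
Definition saddle_sol (w : 'rV[R]_n) : 'rV[R]_m :=
  lsubmx (row_mx 0 w *m invmx saddle).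

(** With multiplier [l], the first block equation reads [vG = l J^T], which makes [v] orthogonal to
    the kernel of [J]; the second reads [vJ = w]. *)
Lemma saddle_solP w : saddle \in unitmx ->
  saddle_sol w *m J = w /\
  forall u : 'rV[R]_m, u *m J = 0 -> (saddle_sol w *m G *m u^T) 0 0 = 0.
Proof.
move=> uS; pose x := row_mx 0 w *m invmx saddle.
have : x *m saddle = row_mx 0 w by rewrite mulmxKV.
rewrite -(hsubmxK x) /saddle mul_row_block => /eq_row_mx[].
rewrite mulmx0 addr0 mulmxN => /eqP; rewrite subr_eq0 => /eqP vG vJ; split=> //.
move=> u uJ; rewrite /saddle_sol -/x vG -mulmxA -trmx_mul uJ trmx0 mulmx0.
by rewrite mxE.
Qed.

End saddle_matrix.

Lemma smooth_at_saddle_sol (R : realType) (V : normedModType R) m n (x : V)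
    (G : V -> 'M[R]_m) (J : V -> 'M[R]_(m, n)) (w : V -> 'rV[R]_n) :
  (forall i j, smooth_at x (fun y => G y i j)) ->
  (forall i j, smooth_at x (fun y => J y i j)) -> smooth_at x w ->
  saddle (G x) (J x) \in unitmx ->
  smooth_at x (fun y => saddle_sol (G y) (J y) (w y)).
Proof.
move=> sG sJ sw uS; apply: smooth_at_row => i.
have sS k l : smooth_at x (fun y => saddle (G y) (J y) k l).
  rewrite /saddle; case: (split_ordP k) => k' ->; case: (split_ordP l) => l' ->.
  - by apply: smooth_at_ext (sG k' l'); near=> y; rewrite block_mxEul.
  - by apply: smooth_at_ext (sJ k' l'); near=> y; rewrite block_mxEur.
  - by apply: smooth_at_ext (smooth_atN (sJ l' k')); near=> y; rewrite block_mxEdl !mxE.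
  - by apply: smooth_at_ext (smooth_at_cst x (0 : R)); near=> y; rewrite block_mxEdr !mxE.
have sI := smooth_at_invmx sS uS.
apply: (@smooth_at_ext _ _ _ _ (fun y => \sum_k row_mx 0 (w y) 0 k *
    invmx (saddle (G y) (J y)) k (lshift n i))).
  by near=> y; rewrite /saddle_sol !mxE.
apply: smooth_at_sum => k _; apply: smooth_atM => //.
case: (split_ordP k) => k' ->.
- by apply: smooth_at_ext (smooth_at_cst x (0 : R)); near=> y; rewrite row_mxEl mxE.
- by apply: smooth_at_ext (smooth_at_coord k' sw); near=> y; rewrite row_mxEr.
Unshelve. all: by end_near. Qed.

Section horizontal_lift.
Variables (R : realType) (m n : nat).
Variables (M : smoothManifold R m) (B : smoothManifold R n).
Variables (g : riemannianMetric M) (pi : M -> B).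
Hypothesis pi_submersion : submersion pi.
Implicit Types (c : chart M) (d : chart B) (p : M).

Let pi_smooth : smooth_map pi. Proof. by case: pi_submersion. Qed.

Definition map_coord c d := chart_map d \o pi \o chart_inv c.

Definition jacobian_coord c d (x : 'rV[R]_m) : 'M[R]_(m, n) :=
  \matrix_(i, j) 'D_(delta_mx 0 i) (map_coord c d) x 0 j.

Lemma diff_jacobian_coord c d x v : differentiable (map_coord c d) x ->
  'd (map_coord c d) x v = v *m jacobian_coord c d x.
Proof.
move=> df; rewrite (diff_sum_delta v df); apply/rowP => j.
by rewrite summxE mxE; apply: eq_bigr => i _; rewrite !mxE.
Qed.

Lemma tangent_map_jacobian c d p (v : tangent p) :
  chart_dom c p -> chart_dom d (pi p) ->
  tangent_coord d (tangent_map pi v) =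
  tangent_coord c v *m jacobian_coord c d (chart_map c p).
Proof.
move=> cp dp; rewrite -diff_jacobian_coord.
  exact: (tangent_map_coord pi_smooth v cp dp).
exact: smooth_at_differentiable (smooth_map_at pi_smooth cp dp).
Qed.

Lemma saddle_coord_unit c d p : chart_dom c p -> chart_dom d (pi p) ->
  saddle (gram g c p) (jacobian_coord c d (chart_map c p)) \in unitmx.
Proof.
move=> cp dp; apply: saddle_unit => [v|w].
  rewrite -{1 2}(tangent_ofK v cp) -metric_coord// => /metric_eq0 v0.
  by rewrite -(tangent_ofK v cp) v0 tangent_coord0.
case: pi_submersion => _ _ /(_ p (tangent_of d (pi p) w))[v vw].
exists (tangent_coord c v); rewrite -tangent_map_jacobian// vw.
exact: tangent_ofK.
Qed.

Definition lift_coord c d p (w : tangent (pi p)) : tangent p :=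
  tangent_of c p (saddle_sol (gram g c p) (jacobian_coord c d (chart_map c p))
    (tangent_coord d w)).

Lemma lift_coordP c d p (w : tangent (pi p)) :
  chart_dom c p -> chart_dom d (pi p) ->
  horizontal g pi (lift_coord c d w) /\ tangent_map pi (lift_coord c d w) = w.
Proof.
move=> cp dp.
have [vJ vG] := saddle_solP (tangent_coord d w) (saddle_coord_unit cp dp); split.
  move=> u; rewrite /vertical /= => u0.
  rewrite (metric_coord _ _ _ cp) tangent_ofK//; apply: vG.
  by rewrite -tangent_map_jacobian// u0 tangent_coord0.
by apply: (tangent_coord_inj dp); rewrite (tangent_map_jacobian _ cp dp) tangent_ofK.
Qed.

(** The difference is both horizontal and vertical, hence orthogonal to itself. *)
Lemma horizontal_inj p (u v : tangent p) : horizontal g pi u -> horizontal g pi v ->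
  tangent_map pi u = tangent_map pi v -> u = v.
Proof.
move=> hu hv uv; have z : vertical pi (u - v).
  by rewrite /vertical /= tangent_mapB uv subrr.
apply/eqP; rewrite -subr_eq0; apply/eqP/(@metric_eq0 _ _ _ g).
by rewrite metricDl metricNl hu// hv// subrr.
Qed.

(** Guarantees that the choices in [hlift] and [hproj] return genuine values and never the default 0
    of an empty set. *)
Lemma horizontal_exists p (w : tangent (pi p)) :
  exists v : tangent p, horizontal g pi v /\ tangent_map pi v = w.
Proof.
exists (lift_coord (chart_at p) (chart_at (pi p)) w).
by apply: lift_coordP; exact: chart_at_dom.
Qed.

Lemma hliftP (Y : vector_field B) p :
  horizontal g pi (hlift g pi Y p) /\ tangent_map pi (hlift g pi Y p) = Y (pi p).
Proof. exact: (@xgetPex _ _ _ (horizontal_exists (Y (pi p)))). Qed.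

Lemma hprojP p (v : tangent p) :
  horizontal g pi (hproj g pi v) /\ vertical pi (v - hproj g pi v).
Proof.
apply: (@xgetPex _ _ [set h | horizontal g pi h /\ vertical pi (v - h)]).
have [h [hh hv]] := horizontal_exists (tangent_map pi v).
by exists h; split => //; rewrite /vertical /= tangent_mapB hv subrr.
Qed.

Lemma tangent_map_hproj p (v : tangent p) :
  tangent_map pi (hproj g pi v) = tangent_map pi v.
Proof.
have [_] := hprojP v; rewrite /vertical /= tangent_mapB => /eqP.
by rewrite subr_eq0 => /eqP.
Qed.

Lemma tangent_map_vproj p (v : tangent p) : tangent_map pi (vproj g pi v) = 0.
Proof. by rewrite /vproj tangent_mapB tangent_map_hproj subrr. Qed.

Lemma hproj_id p (v : tangent p) : horizontal g pi v -> hproj g pi v = v.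
Proof.
by move=> hv; apply: horizontal_inj => //; [case: (hprojP v)|exact: tangent_map_hproj].
Qed.

Lemma vproj_id p (v : tangent p) : tangent_map pi v = 0 -> vproj g pi v = v.
Proof.
move=> v0; suff -> : vproj g pi v = v - 0 by rewrite subr0.
congr (_ - _); apply: horizontal_inj; first by case: (hprojP v).
  by move=> u _; exact: metric0l.
rewrite tangent_map_hproj v0; apply: (addrI (tangent_map pi (0 : tangent p))).
by rewrite -tangent_mapD !addr0.
Qed.

(** A horizontal vector is recovered from its image under [tangent_map pi] by [saddle_sol], so
    smoothness of the image is enough. This treats [hlift] and [hproj] at once. *)
Lemma smooth_field_horizontal (Z : vector_field M) :
  (forall p, horizontal g pi (Z p)) ->
  (forall c d p, chart_dom c p -> chart_dom d (pi p) -> smooth_at (chart_map c p)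
     (fun x => tangent_coord d (tangent_map pi (Z (chart_inv c x))))) ->
  smooth_field Z.
Proof.
move=> hZ sZ; apply: smooth_fieldP => p; exists (chart_at p).
  exact: chart_at_dom.
set c := chart_at p; pose d := chart_at (pi p).
have cp : chart_dom c p := chart_at_dom p.
have dp : chart_dom d (pi p) := chart_at_dom (pi p).
have sf := smooth_map_at pi_smooth cp dp.
have sJ i j : smooth_at (chart_map c p) (fun x => jacobian_coord c d x i j).
  apply: smooth_at_ext (smooth_at_coord j (smooth_at_derive (delta_mx 0 i) sf)).
  by near=> x; rewrite mxE.
have := smooth_at_saddle_sol (fun i j => smooth_at_gram g i j cp) sJ (sZ _ _ _ cp dp).
rewrite chart_mapK// => /(_ (saddle_coord_unit cp dp)).
apply: smooth_at_ext; near=> x.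
have cx : (chart_map c @` chart_dom c) x by near: x; exact: near_img.
have cq := chart_inv_dom cx.
have dq : chart_dom d (pi (chart_inv c x)).
  near: x; apply: (near_chart_inv cp (P := fun q => chart_dom d (pi q))).
  by apply: pi_smooth.1; exact: near_dom.
have [h1 h2] := lift_coordP (tangent_map pi (Z (chart_inv c x))) cq dq.
have E := congr1 (fun v : tangent (chart_inv c x) => tangent_coord c v)
  (horizontal_inj h1 (hZ _) h2).
apply: etrans E; apply/esym; apply: etrans (tangent_ofK _ cq) _.
exact: (congr1 (fun y => saddle_sol _ (jacobian_coord c d y) _) (chart_invK cx)).
Unshelve. all: by end_near. Qed.

Lemma smooth_hlift (Y : vector_field B) : smooth_field Y -> smooth_field (hlift g pi Y).
Proof.
move=> sY; apply: smooth_field_horizontal => [p|c d p cp dp].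
  by case: (hliftP Y p).
have sf := smooth_map_at pi_smooth cp dp.
have sY' : smooth_at ((chart_map d \o pi \o chart_inv c) (chart_map c p))
    (field_coord d Y).
  by rewrite /= chart_mapK//; exact: smooth_field_at.
apply: smooth_at_ext (smooth_at_comp sf sY'); near=> x.
have dq : chart_dom d (pi (chart_inv c x)).
  near: x; apply: (near_chart_inv cp (P := fun q => chart_dom d (pi q))).
  by apply: pi_smooth.1; exact: near_dom.
by have [_ ->] := hliftP Y (chart_inv c x); rewrite -field_coord_chart.
Unshelve. all: by end_near. Qed.

Lemma smooth_hproj (Z : vector_field M) : smooth_field Z ->
  smooth_field (fun p => hproj g pi (Z p)).
Proof.
move=> sZ; apply: smooth_field_horizontal => [p|c d p cp dp].
  by case: (hprojP (Z p)).
have sf := smooth_map_at pi_smooth cp dp.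
apply: smooth_at_ext (smooth_at_diff sf (smooth_field_at sZ cp)); near=> x.
have cx : (chart_map c @` chart_dom c) x by near: x; exact: near_img.
have cq := chart_inv_dom cx.
have dq : chart_dom d (pi (chart_inv c x)).
  near: x; apply: (near_chart_inv cp (P := fun q => chart_dom d (pi q))).
  by apply: pi_smooth.1; exact: near_dom.
rewrite tangent_map_hproj (tangent_map_coord pi_smooth _ cq dq) /field_coord.
by rewrite chart_invK.
Unshelve. all: by end_near. Qed.

Lemma smooth_vproj (Z : vector_field M) : smooth_field Z ->
  smooth_field (fun p => vproj g pi (Z p)).
Proof. by move=> sZ; apply: smooth_fieldB => //; exact: smooth_hproj. Qed.

End horizontal_lift.

(** * The second fundamental form of a map *)

(** Closes [sff_related]: [o] is the image of the derivative of the components of [W], [l] the image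
    of the Christoffel term on [M], [h] the Hessian term, [k] the Christoffel term on [B]. *)
Lemma sub_cancel_mid (V : zmodType) (o l h k : V) :
  o + l = o + h + k - (h - l + k).
Proof. by rewrite (addrC (h - l)) addrKA opprB addrA (addrAC o) addrK. Qed.

Lemma addr3_interchange (V : zmodType) (a a' b b' e e' : V) :
  (a + a') - (b + b') + (e + e') = (a - b + e) + (a' - b' + e').
Proof. by rewrite opprD [X in X + _ = _]addrACA [LHS]addrACA. Qed.

Section second_fundamental_form.
Variables (R : realType) (m n : nat).
Variables (M : smoothManifold R m) (B : smoothManifold R n).
Variables (nablaM : affineConnection M) (nablaB : affineConnection B).
Variables (pi : M -> B).
Hypothesis pi_smooth : smooth_map pi.
Variables (p : M) (c : chart M) (d : chart B).
Hypotheses (cp : chart_dom c p) (dp : chart_dom d (pi p)).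
Variables (G : 'rV[R]_m -> 'rV[R]_m -> 'rV[R]_m).
Variables (H : 'rV[R]_n -> 'rV[R]_n -> 'rV[R]_n).
Hypotheses (G_christoffel : christoffel nablaM c p G).
Hypotheses (H_christoffel : christoffel nablaB d (pi p) H).

Let f := map_coord pi c d.
Let x0 := chart_map c p.

Let sf : smooth_at x0 f. Proof. exact: smooth_map_at. Qed.
Let df : differentiable f x0. Proof. exact: smooth_at_differentiable. Qed.
Let fx0 : f x0 = chart_map d (pi p).
Proof. by rewrite /f /map_coord /= chart_mapK. Qed.

Let LD u v : 'd f x0 (u + v) = 'd f x0 u + 'd f x0 v.
Proof. exact: linearD. Qed.

Let near_dq : \forall x \near x0, [/\ (chart_map c @` chart_dom c) x,
  chart_dom c (chart_inv c x) & chart_dom d (pi (chart_inv c x))].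
Proof.
have n1 := near_img cp.
have nF : \forall q \near p, chart_dom d (pi q) by apply: pi_smooth.1; exact: near_dom.
have n2 := near_chart_inv cp nF.
near=> x; have cx : (chart_map c @` chart_dom c) x by near: x.
by split => //; [exact: chart_inv_dom|near: x].
Unshelve. all: by end_near. Qed.

(* Coordinates of the second fundamental form [(nabla dpi)(u, v)] of the map
   [pi] with respect to the two connections. *)
Definition sff (u v : 'rV[R]_m) : 'rV[R]_n :=
  hess f x0 u v - 'd f x0 (G u v) + H ('d f x0 u) ('d f x0 v).

Lemma sffDl u u' v : sff (u + u') v = sff u v + sff u' v.
Proof.
have [[GDl _ _] _] := G_christoffel; have [[HDl _ _] _] := H_christoffel.
rewrite /sff hessDl GDl !LD HDl.
exact: addr3_interchange.
Qed.

Lemma sffDr u v v' : sff u (v + v') = sff u v + sff u v'.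
Proof.
have [[_ GDr _] _] := G_christoffel; have [[_ HDr _] _] := H_christoffel.
rewrite /sff hessDr GDr !LD HDr.
exact: addr3_interchange.
Qed.

Lemma derive_diff_field (Z : vector_field M) (u : 'rV[R]_m) : smooth_field Z ->
  is_derive x0 u (fun x => 'd f x (field_coord c Z x))
    ('d f x0 ('d (field_coord c Z) x0 u) + hess f x0 u (tangent_coord c (Z p))).
Proof.
move=> sZ; have sZx := smooth_field_at sZ cp; have dZ := smooth_at_differentiable sZx.
have := is_derive_diff (v := u) (x := id) sf (smooth_at_differentiable (smooth_at_id x0))
  (diff_derivable dZ).
by rewrite derive_id (deriveE _ dZ) field_coord_chart.
Qed.

(** The hypotheses are asymmetric since a connection is tensorial in its first slot: [E] and [E']
    are compared at [p] alone, whereas the relation between [W] and [Y] gets differentiated. *)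
Lemma sff_related (E W : vector_field M) (E' Y : vector_field B) :
  smooth_field E -> smooth_field W -> smooth_field E' -> smooth_field Y ->
  tangent_map pi (E p) = E' (pi p) ->
  (forall q, tangent_map pi (W q) = Y (pi q)) ->
  tangent_coord d (tangent_map pi (nablaM E W p)) =
  tangent_coord d (nablaB E' Y (pi p)) -
  sff (tangent_coord c (E p)) (tangent_coord c (W p)).
Proof.
move=> sE sW sE' sY EE' WY.
have [_ GE] := G_christoffel; have [_ HE] := H_christoffel.
set e := tangent_coord c (E p); set w := tangent_coord c (W p).
have Le : 'd f x0 e = tangent_coord d (E' (pi p)).
  by rewrite -EE'; exact: esym (tangent_map_coord pi_smooth _ cp dp).
have Lw : 'd f x0 w = tangent_coord d (Y (pi p)).
  by rewrite -WY; exact: esym (tangent_map_coord pi_smooth _ cp dp).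
have near_WY : \forall x \near x0,
    'd f x (field_coord c W x) = field_coord d Y (f x).
  have := near_dq; apply: filterS => x [cx cq dq].
  have E1 := congr1 (fun y => 'd f y (field_coord c W x)) (esym (chart_invK cx)).
  have E2 := tangent_map_coord pi_smooth (W (chart_inv c x)) cq dq.
  have E3 := congr1 (fun v : tangent (pi (chart_inv c x)) => tangent_coord d v)
    (WY (chart_inv c x)).
  exact: etrans E1 (etrans (esym E2) (etrans E3 (esym (field_coord_chart Y dq)))).
have dY : differentiable (field_coord d Y) (f x0).
  by rewrite fx0; exact: smooth_at_differentiable (smooth_field_at sY dp).
(* The same function is differentiated along [e] by the product rule and, as [field_coord d Y]
   composed with [f], by the chain rule. *)
have [_ D1] := near_eq_is_derive near_WY (derive_diff_field e sW).
have [_ D2] := is_derive_diff_comp e df dY.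
have D := etrans (esym D2) D1; rewrite (deriveE e df) Le fx0 in D.
rewrite HE// D -Le -Lw /sff.
have -> : tangent_coord d (tangent_map pi (nablaM E W p)) =
    'd f x0 (tangent_coord c (nablaM E W p)).
  exact: (tangent_map_coord pi_smooth _ cp dp).
rewrite GE// LD -/e -/w -/x0.
exact: sub_cancel_mid.
Qed.

(** Removing the [H] terms sets aside the possible torsion of [nablaB]; what remains is the Hessian
    minus the image of the Christoffel term of [nablaM]. *)
Lemma sff_sym (u v : tangent p) : torsion_free nablaM ->
  sff (tangent_coord c u) (tangent_coord c v) -
    H (tangent_coord d (tangent_map pi u)) (tangent_coord d (tangent_map pi v)) =
  sff (tangent_coord c v) (tangent_coord c u) -
    H (tangent_coord d (tangent_map pi v)) (tangent_coord d (tangent_map pi u)).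
Proof.
move=> tors.
rewrite !(tangent_map_coord pi_smooth _ cp dp) /sff -/f -/x0 !addrK.
have [sX Xp] := extensionP u; have [sY Yp] := extensionP v.
set X := extension u; set Y := extension v; rewrite -/X in sX Xp; rewrite -/Y in sY Yp.
have [_ GE] := G_christoffel.
pose N := chart_dom c `&` pi @^-1` chart_dom d.
have oN : open N.
  apply: openI; first exact: chart_dom_open.
  by apply: open_comp; [move=> q _; exact: pi_smooth.1|exact: chart_dom_open].
have [b [sb b1 Nb]] := cutoff_exists oN (conj cp dp).
apply/rowP => k.
(* The test function: the [k]-th coordinate of [pi], made global by a cutoff equal to 1 near [p]. *)
pose h q := b q * chart_map d (pi q) 0 k.
have sh : smooth_function h.
  apply: (smooth_function_cutoff sb Nb) => q [cq dq]; exists c => //.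
  exact: (smooth_at_coord k (smooth_map_at pi_smooth cq dq)).
have near_h : \forall x \near x0, (h \o chart_inv c) x = f x 0 k.
  have := near_chart_inv cp b1; apply: filterS => x bx.
  by rewrite /= /h bx mul1r.
have near_dh (Z : vector_field M) : \forall x \near x0,
    ((fun q => dfunction h (Z q)) \o chart_inv c) x = 'd f x (field_coord c Z x) 0 k.
  near=> x.
  have [cx cq dq] : [/\ (chart_map c @` chart_dom c) x,
    chart_dom c (chart_inv c x) & chart_dom d (pi (chart_inv c x))] by near: x.
  have sfx : smooth_at x f by near: x; exact: (smooth_at_near sf).
  (* A derivative at [x] requires equality around [x], not only at [x]; hence the passage to the
     interior of the neighbourhood. *)
  have hx : \forall y \near x, (h \o chart_inv c) y = f y 0 k.
    by near: x; exact: nbhs_interior.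
  have dhx := smooth_at_differentiable (smooth_function_at sh cq).
  rewrite /= (dfunction_coord _ cq dhx).
  have E1 := congr1 (fun y => 'd (h \o chart_inv c) y (field_coord c Z x)) (chart_invK cx).
  have dhx' : differentiable (h \o chart_inv c) x.
    exact: (eq_ind _ (fun y => differentiable (h \o chart_inv c) y) dhx _ (chart_invK cx)).
  have E2 := congr1 (fun g : _ -> _ => g (field_coord c Z x)) (near_eq_diff hx dhx').
  have E3 := diff_coord (field_coord c Z x) k (smooth_at_differentiable sfx).
  exact: etrans E1 (etrans E2 E3).
have second (Z : vector_field M) (w : tangent p) : smooth_field Z ->
    dfunction (fun q => dfunction h (Z q)) w =
    ('d f x0 ('d (field_coord c Z) x0 (tangent_coord c w)) +
     hess f x0 (tangent_coord c w) (tangent_coord c (Z p))) 0 k.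
  move=> sZ.
  have sD := smooth_at_diff sf (smooth_field_at sZ cp).
  have sDk := smooth_at_coord k sD.
  have near_dh' : \forall x \near x0, 'd f x (field_coord c Z x) 0 k =
      ((fun q => dfunction h (Z q)) \o chart_inv c) x.
    by have := near_dh Z; apply: filterS => x ->.
  have sdh := smooth_at_differentiable (smooth_at_ext near_dh' sDk).
  rewrite (dfunction_coord _ cp sdh).
  have E1 := congr1 (fun g : _ -> _ => g (tangent_coord c w)) (near_eq_diff (near_dh Z) sdh).
  have E2 := diff_coord (tangent_coord c w) k (smooth_at_differentiable sD).
  have [_ E3] := derive_diff_field (tangent_coord c w) sZ.
  rewrite (deriveE _ (smooth_at_differentiable sD)) in E3.
  exact: etrans E1 (etrans E2 (congr1 (fun r : 'rV_n => r 0 k) E3)).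
have dh (w : tangent p) : dfunction h w = 'd f x0 (tangent_coord c w) 0 k.
  have dhx := smooth_at_differentiable (smooth_function_at sh cp).
  rewrite (dfunction_coord _ cp dhx).
  have E2 := congr1 (fun g : _ -> _ => g (tangent_coord c w)) (near_eq_diff near_h dhx).
  exact: etrans E2 (diff_coord (tangent_coord c w) k df).
have := tors X Y sX sY h sh p.
rewrite dh (second _ _ sX) (second _ _ sY) tangent_coordB !GE// Xp Yp -/x0.
have LB : forall a b, 'd f x0 (a - b) = 'd f x0 a - 'd f x0 b by move=> a' b'; exact: linearB.
rewrite LB !LD.
move: (hess _ _ (tangent_coord c u) _) (hess _ _ (tangent_coord c v) _) => h1 h2.
move: ('d f x0 (G (tangent_coord c u) _)) ('d f x0 (G (tangent_coord c v) _)) => l1 l2.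
move: ('d f x0 ('d (field_coord c X) _ _)) ('d f x0 ('d (field_coord c Y) _ _)) => o1 o2.
(* The derivatives of the components of the two extensions, [o1] and [o2], occur on both sides of
   the bracket identity and cancel. *)
by rewrite !mxE => E; lra.
Unshelve. all: by end_near. Qed.

End second_fundamental_form.

(** * Acceleration of the image of a geodesic *)

Section image_of_a_curve.
Variables (R : realType) (m n : nat).
Variables (M : smoothManifold R m) (B : smoothManifold R n).
Variables (nablaM : affineConnection M) (nablaB : affineConnection B).
Variables (pi : M -> B).
Hypothesis pi_smooth : smooth_map pi.
Variables (I : set R) (s : R -> M).
Hypotheses (I_open : open I) (s_smooth : smooth_curve I s).
Implicit Types (c : chart M) (d : chart B).

Lemma derivable_velocity c t : I t -> chart_dom c (s t) ->
  derivable (fun r => tangent_coord c (velocity s r)) t 1.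
Proof.
move=> It ct.
have sx := smooth_curve_at I_open s_smooth It ct.
have e : \forall r \near t, 'D_1 (chart_map c \o s) r = tangent_coord c (velocity s r).
  have nd := curve_near s_smooth It (near_dom ct).
  have nI : \forall r \near t, I r by exact: open_nbhs_nbhs.
  near=> r; apply/esym/(velocity_coord I_open s_smooth); by near: r.
apply: near_eq_derivable e _; apply: diff_derivable.
exact: smooth_at_differentiable (smooth_at_derive (1:R) sx).
Unshelve. all: by end_near. Qed.

Lemma covariant_derivative_map c d t (w : tangent (pi (s t))) G H :
  I t -> chart_dom c (s t) -> chart_dom d (pi (s t)) ->
  christoffel nablaM c (s t) G -> christoffel nablaB d (pi (s t)) H ->
  is_covariant_derivative nablaM (velocity s) (0 : tangent (s t)) ->
  is_covariant_derivative nablaB (velocity (pi \o s)) (t := t) w ->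
  tangent_coord d w = sff pi (s t) c d G H
    (tangent_coord c (velocity s t)) (tangent_coord c (velocity s t)).
Proof.
move=> It ct dt chG chH geo cov.
have ps_smooth := smooth_map_curve pi_smooth I_open s_smooth.
have Dz := covariant_derivative_coord I_open s_smooth It ct chG geo.
rewrite (covariant_derivative_coord I_open ps_smooth It dt chH cov).
rewrite tangent_coord0 in Dz.
have sf := smooth_map_at pi_smooth ct dt.
have dx := smooth_at_differentiable (smooth_curve_at I_open s_smooth It ct).
have D := is_derive_diff (x := chart_map c \o s) sf dx (derivable_velocity It ct).
have e : \forall r \near t, 'd (chart_map d \o pi \o chart_inv c) ((chart_map c \o s) r)
    (tangent_coord c (velocity s r)) = tangent_coord d (velocity (pi \o s) r).
  have := map_curve_near pi_smooth I_open s_smooth It ct dt.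
  apply: filterS => r [Ir cr dr].
  have E1 := congr1 (fun v : tangent (pi (s r)) => tangent_coord d v)
    (velocity_map pi_smooth I_open s_smooth Ir).
  exact: esym (etrans E1 (tangent_map_coord pi_smooth _ cr dr)).
have [_ D1] := near_eq_is_derive e D.
have vE := velocity_coord I_open s_smooth It ct.
have E1 := congr1 (fun v : tangent (pi (s t)) => tangent_coord d v)
    (velocity_map pi_smooth I_open s_smooth It).
have E2 := etrans E1 (tangent_map_coord pi_smooth _ ct dt).
rewrite D1 -vE E2 /sff /map_coord.
set v := tangent_coord c _ in Dz *; rewrite -/v in Dz.
(* The geodesic equation in the chart [c]; its image under the differential supplies the middle term
   of [sff]. *)
have -> : 'D_1 (fun r => tangent_coord c (velocity s r)) t = - G v v.
  by apply/eqP; rewrite -addr_eq0 -Dz.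
have LN u : 'd ((chart_map d \o pi) \o chart_inv c) (chart_map c (s t)) (- u) =
    - 'd ((chart_map d \o pi) \o chart_inv c) (chart_map c (s t)) u.
  exact: linearN.
by rewrite LN [X in X + _ = _]addrC.
Qed.

End image_of_a_curve.

(** * The second fundamental form on horizontal and vertical vectors *)

Section horizontal_vertical_components.
Variables (R : realType) (m n : nat).
Variables (M : smoothManifold R m) (B : smoothManifold R n).
Variables (gM : riemannianMetric M) (gB : riemannianMetric B).
Variables (nablaM : affineConnection M) (nablaB : affineConnection B).
Variables (pi : M -> B) (phi : M -> R).
Hypothesis pi_submersion : submersion pi.
Variables (p : M) (c : chart M) (d : chart B).
Hypotheses (cp : chart_dom c p) (dp : chart_dom d (pi p)).
Variables (G : 'rV[R]_m -> 'rV[R]_m -> 'rV[R]_m).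
Variables (H : 'rV[R]_n -> 'rV[R]_n -> 'rV[R]_n).
Hypotheses (G_christoffel : christoffel nablaM c p G).
Hypotheses (H_christoffel : christoffel nablaB d (pi p) H).

Let pi_smooth : smooth_map pi. Proof. by case: pi_submersion. Qed.

Lemma sff_vertical (E W : vector_field M) :
  smooth_field E -> smooth_field W -> (forall q, vertical pi (W q)) ->
  tangent_coord d (tangent_map pi (nablaM E W p)) =
  - sff pi p c d G H (tangent_coord c (E p)) (tangent_coord c (W p)).
Proof.
move=> sE sW vW.
(* [E] need not project to a field on [B]; any field through [tangent_map pi (E p)] can play the
   role of [E']. *)
have [sE' EE'] := extensionP (tangent_map pi (E p)).
rewrite (sff_related pi_smooth cp dp G_christoffel H_christoffel sE sW sE'
  (@smooth_field0 R n B) (esym EE') vW).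
by rewrite conn0r// tangent_coord0 sub0r.
Qed.

(** [tangent_map pi] kills the vertical summand of A and does not see the projection in the other.
    The extensions of [x] and [u] are projected inside [tensorA]; at [p] this returns [x] and [u],
    and everywhere it makes the second field vertical. *)
Lemma sff_horizontal_vertical (x u : tangent p) : horizontal gM pi x ->
  tangent_map pi u = 0 ->
  tangent_coord d (tangent_map pi (tensorA nablaM gM pi x u)) =
  - sff pi p c d G H (tangent_coord c x) (tangent_coord c u).
Proof.
move=> hx vu; have [sX Xp] := extensionP x; have [sU Up] := extensionP u.
rewrite /tensorA /tensorA_field /= tangent_mapD tangent_map_vproj// add0r.
rewrite tangent_map_hproj//.
rewrite (sff_vertical (smooth_hproj gM pi_submersion sX)
                      (smooth_vproj gM pi_submersion sU)).
  by rewrite Xp Up hproj_id// vproj_id.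
by move=> q; exact: tangent_map_vproj.
Qed.

Lemma sff_vertical_vertical (u : tangent p) : tangent_map pi u = 0 ->
  tangent_coord d (tangent_map pi (tensorT nablaM gM pi u u)) =
  - sff pi p c d G H (tangent_coord c u) (tangent_coord c u).
Proof.
move=> vu; have [sU Up] := extensionP u.
rewrite /tensorT /tensorT_field /= tangent_mapD tangent_map_vproj// addr0.
rewrite tangent_map_hproj//.
rewrite (sff_vertical (smooth_vproj gM pi_submersion sU)
                      (smooth_vproj gM pi_submersion sU)).
  by rewrite Up vproj_id.
by move=> q; exact: tangent_map_vproj.
Qed.

Lemma sff_horizontal (x : tangent p) :
  conformal_submersion_hdist nablaM gM nablaB gB pi phi -> horizontal gM pi x ->
  sff pi p c d G H (tangent_coord c x) (tangent_coord c x) =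
  - tangent_coord d ((2 * dfunction phi x) *: tangent_map pi x
    - gM p x x *: tangent_map pi (gradient gM phi p)).
Proof.
move=> [_ hdist] hx.
have [sY Yp] := extensionP (tangent_map pi x); set Y := extension _ in sY Yp.
have sY' := smooth_hlift gM pi_submersion sY.
have lY q : tangent_map pi (hlift gM pi Y q) = Y (pi q).
  by case: (hliftP gM pi_submersion Y q).
(* The lift of any extension of [tangent_map pi x] passes through [x], so the axiom on lifts
   computes [sff] at [x]. Its two terms in [phi] coincide, hence the coefficient 2. *)
have Y'p : hlift gM pi Y p = x.
  apply: (horizontal_inj (g := gM) (pi := pi)) => //.
    by case: (hliftP gM pi_submersion Y p).
  by rewrite lY.
have rel := sff_related pi_smooth cp dp G_christoffel H_christoffel sY' sY' sY sY
  (lY p) lY.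
have := congr1 (fun v : tangent p => tangent_map pi v) (hdist Y Y sY sY p).
have [_ lN] := hliftP gM pi_submersion (nablaB Y Y) p.
rewrite Y'p tangent_mapB !tangent_mapD !tangent_mapZ !tangent_map_hproj// lN => E.
rewrite Y'p E in rel; move: rel.
rewrite !(tangent_coordB, tangent_coordD, tangent_coordZ).
move: (sff _ _ _ _ _ _ _ _) (tangent_coord d (nablaB Y Y (pi p))) => q a.
move: (tangent_coord d (tangent_map pi x)) (tangent_coord d _) => b e.
move: (dfunction phi x) (gM p x x) => r k.
move=> /rowP rel; apply/rowP => i; have := rel i; rewrite !mxE; lra.
Qed.

End horizontal_vertical_components.

Theorem theorem5 (R : realType) (m n : nat) (dim_lt : (n < m)%N)
    (M : smoothManifold R m) (B : smoothManifold R n)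
    (gM : riemannianMetric M) (gB : riemannianMetric B)
    (nablaM : affineConnection M) (nablaB : affineConnection B)
    (pi : M -> B) (phi : M -> R)
    (pi_conformal : conformal_submersion_hdist nablaM gM nablaB gB pi phi)
    (nablaM_torsion_free : torsion_free nablaM)
    (I : set R) (I_open : open I) (I_itv : is_interval I)
    (sigma : R -> M) (sigma_geodesic : geodesic nablaM I sigma) :
  geodesic nablaB I (pi \o sigma) <->
  (forall t : R, I t ->
     let X := hproj gM pi (velocity sigma t) in
     let U := vproj gM pi (velocity sigma t) in
     tangent_map pi (2 *: tensorA nablaM gM pi X U + tensorT nablaM gM pi U U)
     + (2 * dfunction phi X) *: tangent_map pi X
     = gM (sigma t) X X *: tangent_map pi (gradient gM phi (sigma t))).
Proof.
have pi_sub : submersion pi by case: pi_conformal => -[].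
have pi_smooth : smooth_map pi by case: pi_sub.
have [s_smooth s_geo] := sigma_geodesic.
have ps_smooth := smooth_map_curve pi_smooth I_open s_smooth.
(* The image curve is smooth in any case, so the equivalence can be proved separately at each
   parameter. *)
suff key t : I t -> is_covariant_derivative nablaB (velocity (pi \o sigma))
      (0 : tangent (pi (sigma t))) <->
    (let X := hproj gM pi (velocity sigma t) in
     let U := vproj gM pi (velocity sigma t) in
     tangent_map pi (2 *: tensorA nablaM gM pi X U + tensorT nablaM gM pi U U)
     + (2 * dfunction phi X) *: tangent_map pi X
     = gM (sigma t) X X *: tangent_map pi (gradient gM phi (sigma t))).
  split=> [[_ geo] t It|eqn]; first exact: (key t It).1 (geo t It).
  by split=> // t It; exact: (key t It).2 (eqn t It).
move=> It; set X := hproj gM pi _; set U := vproj gM pi _;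
pose c := chart_at (sigma t); pose d := chart_at (pi (sigma t)).
have cp : chart_dom c (sigma t) := chart_at_dom (sigma t).
have dp : chart_dom d (pi (sigma t)) := chart_at_dom (pi (sigma t)).
have [G chG] := christoffel_exists nablaM cp.
have [H chH] := christoffel_exists nablaB dp.
have [w cov] := covariant_derivative_exists nablaB ps_smooth It dp
  (derivable_velocity I_open ps_smooth It dp).
pose Q := sff pi (sigma t) c d G H.
have wE w' : is_covariant_derivative nablaB (velocity (pi \o sigma)) (t := t) w' ->
    tangent_coord d w' = Q (tangent_coord c (velocity sigma t))
                           (tangent_coord c (velocity sigma t)).
  exact: (covariant_derivative_map pi_smooth I_open s_smooth It cp dp chG chH
    (s_geo t It)).
have hX : horizontal gM pi X by case: (hprojP gM pi_sub (velocity sigma t)).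
have vU : tangent_map pi U = 0 by exact: tangent_map_vproj.
have XU : velocity sigma t = X + U by rewrite /U /vproj addrC subrK.
set x := tangent_coord c X; set u := tangent_coord c U.
(* The two [H] terms left by [sff_sym] have the argument [tangent_map pi U = 0]. *)
have Qsym : Q u x = Q x u.
  have := sff_sym pi_smooth cp dp H chG U X nablaM_torsion_free.
  rewrite vU tangent_coord0; have [[HDl HDr _] _] := chH.
  have H0l v : H 0 v = 0 by apply: (addrI (H 0 v)); rewrite -HDl !addr0.
  have H0r v : H v 0 = 0 by apply: (addrI (H v 0)); rewrite -HDr !addr0.
  by rewrite H0l H0r !subr0.
(* Q on the velocity is minus the difference of the two sides of the claimed equation, in
   coordinates. *)
have QE : Q (tangent_coord c (velocity sigma t)) (tangent_coord c (velocity sigma t)) =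
    - tangent_coord d (tangent_map pi
        (2 *: tensorA nablaM gM pi X U + tensorT nablaM gM pi U U)
     + (2 * dfunction phi X) *: tangent_map pi X
     - gM (sigma t) X X *: tangent_map pi (gradient gM phi (sigma t))).
  rewrite XU tangent_coordD -/x -/u.
  have QDl v v' z : Q (v + v') z = Q v z + Q v' z by exact: (sffDl chG chH).
  have QDr v z z' : Q v (z + z') = Q v z + Q v z' by exact: (sffDr chG chH).
  rewrite QDl !QDr Qsym.
  have Qxx : Q x x = _ := sff_horizontal pi_sub cp dp chG chH pi_conformal hX.
  have Qxu : _ = - Q x u := sff_horizontal_vertical pi_sub cp dp chG chH hX vU.
  have Quu : _ = - Q u u := sff_vertical_vertical gM pi_sub cp dp chG chH vU.
  rewrite Qxx -[Q x u]opprK -Qxu -[Q u u]opprK -Quu.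
  move: (tensorA _ _ _ _ _) (tensorT _ _ _ _ _) => tA tT {Qxu Quu}.
  rewrite tangent_mapD tangent_mapZ !(tangent_coordB, tangent_coordD, tangent_coordZ).
  move: (tangent_coord d (tangent_map pi tA)) (tangent_coord d (tangent_map pi tT)) => a b.
  move: (tangent_coord d (tangent_map pi X)) (tangent_coord d (tangent_map pi _)) => y z.
  by apply/rowP => i; rewrite !mxE; lra.
split=> [cov0|eqn].
- apply/eqP; rewrite -subr_eq0; apply/eqP; apply: (tangent_coord_inj dp).
  by rewrite -[LHS]opprK -QE -(wE _ cov0) tangent_coord0 oppr0.
(* The covariant derivative [w] obtained from the existence lemma is identified with 0. *)
- suff w0 : w = 0 by rewrite -w0.
  apply: (tangent_coord_inj dp).
  by rewrite (wE _ cov) QE eqn subrr !tangent_coord0 oppr0.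
Qed.
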